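(* Let $n\ge1$, let $c_n=\frac{1}{n+1}\binom{2n}{n}$, let $N_{n,k}=\frac1n\binom nk\binom n{k+1}$ for $k\ge0$, and put $N_{n,-1}=0$. 1. As an $S_n$-module, $\mathrm{As}^2(n)$ is free of rank $c_n$ (i.e. a direct sum of $c_n$ copies of the regular representation $\Bbbk S_n$). 2. As an $S_n\times SL_2$-module, $$\mathrm{As}^2(n)\simeq \Bbbk S_n\otimes\bigoplus_{0\le k\le (n-1)/2}L(n-1-2k)^{\oplus (N_{n,k}-N_{n,k-1})},$$ that is, $\mathrm{As}^2(n)\simeq \Bbbk S_n\otimes\bigl(L(n-1)\oplus L(n-3)^{N_{n,1}-1}\oplus L(n-5)^{N_{n,2}-N_{n,1}}\oplus\cdots\bigr)$.
   Context: Work over a field $\Bbbk$ of characteristic zero. An algebra with two compatible associative products is a (not necessarily unital) vector space with two bilinear operations $\star_1,\star_2$ such that each is associative, $(a\star_i b)\star_i c=a\star_i(b\star_i c)$ for $i=1,2$, and $$(a\star_1 b)\star_2 c+(a\star_2 b)\star_1 c=a\star_1 (b\star_2 c)+a\star_2 (b\star_1 c).$$ The operad $\mathrm{As}^2$ is the operad (with $\mathrm{As}^2(1)=\Bbbk$) generated by two binary operations $\star_1,\star_2$ without symmetry, subject to exactly these relations. Its component $\mathrm{As}^2(n)$ is the multilinear part (the span of elements in which each generator occurs exactly once) of the free algebra with two compatible associative products on $n$ generators; $S_n$ acts by permuting the generators. The group $SL_2$ acts on $\mathrm{As}^2$ by operad automorphisms: it acts on the two-dimensional span of $\star_1,\star_2$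 as on its standard two-dimensional representation, and this action commutes with the $S_n$-actions. $L(m)$ denotes the irreducible $SL_2$-module of dimension $m+1$. In $\Bbbk S_n\otimes W$, $S_n$ acts on the first factor (regular representation) and $SL_2$ on the second. *)

(* Defs.v *)
From HB Require Import structures.
From mathcomp Require Import all_boot all_order all_fingroup all_algebra.
From mathcomp Require Import generic_quotient boolp mpoly.

Set Implicit Arguments.
Unset Strict Implicit.
Unset Printing Implicit Defensive.
Import GRing.Theory.
Local Open Scope ring_scope.

Section DirectSumModule.
Variables (k : fieldType) (I : finType) (V : I -> lmodType k).
Implicit Types x y z : {dffun forall i, V i}.

Definition dsum_zero : {dffun forall i, V i} := finfun (fun i => 0 : V i).
Definition dsum_opp x : {dffun forall i, V i} := finfun (fun i => - x i).
Definition dsum_add x y : {dffun forall i, V i} := finfun (fun i => x i + y i).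
Definition dsum_scale a x : {dffun forall i, V i} := finfun (fun i => a *: x i).

Lemma dsum_addA : associative dsum_add.
Proof. by move=> x y z; apply/ffunP=> i; rewrite !ffunE addrA. Qed.
Lemma dsum_addC : commutative dsum_add.
Proof. by move=> x y; apply/ffunP=> i; rewrite !ffunE addrC. Qed.
Lemma dsum_add0 : left_id dsum_zero dsum_add.
Proof. by move=> x; apply/ffunP=> i; rewrite !ffunE add0r. Qed.
Lemma dsum_addN : left_inverse dsum_zero dsum_opp dsum_add.
Proof. by move=> x; apply/ffunP=> i; rewrite !ffunE addNr. Qed.

HB.instance Definition _ := GRing.isZmodule.Build {dffun forall i, V i}
  dsum_addA dsum_addC dsum_add0 dsum_addN.

Lemma dsum_scaleA a b x : dsum_scale a (dsum_scale b x) = dsum_scale (a * b) x.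
Proof. by apply/ffunP=> i; rewrite !ffunE scalerA. Qed.
Lemma dsum_scale1 : left_id 1 dsum_scale.
Proof. by move=> x; apply/ffunP=> i; rewrite !ffunE scale1r. Qed.
Lemma dsum_scaleDr : right_distributive dsum_scale +%R.
Proof. by move=> a x y; apply/ffunP=> i; rewrite !ffunE scalerDr. Qed.
Lemma dsum_scaleDl x : {morph dsum_scale^~ x : a b / a + b}.
Proof. by move=> a b; apply/ffunP=> i; rewrite !ffunE scalerDl. Qed.

HB.instance Definition _ := GRing.Zmodule_isLmodule.Build k
  {dffun forall i, V i} dsum_scaleA dsum_scale1 dsum_scaleDr dsum_scaleDl.

End DirectSumModule.

Record rep (k : fieldType) (G : groupType) := Rep {
  rep_sort :> lmodType k;
  rep_act : G -> rep_sort -> rep_sort;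
  rep_act_linear : forall g, linear (rep_act g);
  rep_act1 : forall x, rep_act 1%g x = x;
  rep_actM : forall g h x, rep_act (g * h)%g x = rep_act g (rep_act h x)
}.

Section Representations.
Variable k : fieldType.

Definition rep_iso (G : groupType) (V W : rep k G) : Prop :=
  exists f : {linear V -> W},
    bijective f /\ forall g x, f (rep_act g x) = rep_act g (f x).

Definition irreducible (G : groupType) (V : rep k G) : Prop :=
  (exists x : V, x != 0) /\
  forall P : V -> Prop,
    (forall a x y, P x -> P y -> P (a *: x + y)) ->
    (forall g x, P x -> P (rep_act g x)) ->
    (exists2 x, P x & x != 0) -> forall x, P x.

Section DirectSum.
Variables (G : groupType) (I : finType) (V : I -> rep k G).

Definition dsum_act (g : G) (x : {dffun forall i, V i}) : {dffun forall i, V i}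
  := finfun (fun i => rep_act g (x i)).

Lemma dsum_act_linear g : linear (dsum_act g).
Proof. by move=> a x y; apply/ffunP=> i; rewrite !ffunE rep_act_linear. Qed.
Lemma dsum_act1 x : dsum_act 1%g x = x.
Proof. by apply/ffunP=> i; rewrite !ffunE rep_act1. Qed.
Lemma dsum_actM g h x : dsum_act (g * h)%g x = dsum_act g (dsum_act h x).
Proof. by apply/ffunP=> i; rewrite !ffunE rep_actM. Qed.

Definition dsum : rep k G := Rep dsum_act_linear dsum_act1 dsum_actM.
End DirectSum.

Definition rep_power (G : groupType) (V : rep k G) (m : nat) : rep k G :=
  dsum (fun _ : 'I_m => V).

Section Regular.
Variable G : finGroupType.

(* f stands for \sum_s f s *: e_s, so that g * e_s = e_(g * s). *)
Definition regular_act (g : G) (f : {ffun G -> k^o}) : {ffun G -> k^o} :=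
  [ffun s => f (g^-1 * s)%g].

Lemma regular_act_linear g : linear (regular_act g).
Proof. by move=> a x y; apply/ffunP=> i; rewrite !ffunE. Qed.
Lemma regular_act1 x : regular_act 1%g x = x.
Proof. by apply/ffunP=> i; rewrite !ffunE invg1 mul1g. Qed.
Lemma regular_actM g h x :
  regular_act (g * h)%g x = regular_act g (regular_act h x).
Proof. by apply/ffunP=> i; rewrite !ffunE invMg mulgA. Qed.

Definition regular : rep k G :=
  Rep regular_act_linear regular_act1 regular_actM.

(* The external tensor product kG (x) W, as a G x H-module: f stands for
   \sum_s e_s (x) f s, so that (g, h) * (e_s (x) w) = e_(g * s) (x) (h * w). *)
Variables (H : groupType) (W : rep k H).

Definition regular_tensor_act (gh : G * H) (f : {ffun G -> W}) : {ffun G -> W} :=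
  [ffun s => rep_act gh.2 (f (gh.1^-1 * s)%g)].

Lemma regular_tensor_act_linear g : linear (regular_tensor_act g).
Proof. by move=> a x y; apply/ffunP=> i; rewrite !ffunE rep_act_linear. Qed.
Lemma regular_tensor_act1 x : regular_tensor_act 1%g x = x.
Proof. by apply/ffunP=> i; rewrite !ffunE /= rep_act1 invg1 mul1g. Qed.
Lemma regular_tensor_actM g h x :
  regular_tensor_act (g * h)%g x = regular_tensor_act g (regular_tensor_act h x).
Proof. by apply/ffunP=> i; rewrite !ffunE /= rep_actM invMg mulgA. Qed.

Definition regular_tensor : rep k (G * H)%type :=
  Rep regular_tensor_act_linear regular_tensor_act1 regular_tensor_actM.
End Regular.

Section Restriction.
Variables (G H : groupType) (V : rep k (G * H)%type).

Definition resl_act (g : G) (x : V) : V := rep_act (g, 1%g) x.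
Lemma resl_act_linear g : linear (resl_act g).
Proof. by move=> a x y; exact: rep_act_linear. Qed.
Lemma resl_act1 x : resl_act 1%g x = x.
Proof. exact: rep_act1. Qed.
Lemma resl_actM g h x : resl_act (g * h)%g x = resl_act g (resl_act h x).
Proof. by rewrite /resl_act -rep_actM; congr rep_act; congr pair; rewrite mulg1. Qed.

Definition resl : rep k G := Rep resl_act_linear resl_act1 resl_actM.
End Restriction.

End Representations.

Record SL2 (k : fieldType) := SL2of {
  SL2val :> 'M[k]_2;
  _ : \det SL2val == 1
}.

Section SL2Group.
Variable k : fieldType.

HB.instance Definition _ := [isSub for @SL2val k].
HB.instance Definition _ := [Choice of SL2 k by <:].

Lemma SL2_det (g : SL2 k) : \det g = 1.
Proof. by apply/eqP; case: g. Qed.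

Lemma SL2_one_subproof : \det (1%:M : 'M[k]_2) == 1.
Proof. by rewrite det1. Qed.
Lemma SL2_mul_subproof (g h : SL2 k) :
  \det (SL2val g *m SL2val h) == 1.
Proof. by rewrite det_mulmx !SL2_det mulr1. Qed.
Lemma SL2_inv_subproof (g : SL2 k) : \det (invmx (SL2val g)) == 1.
Proof. by rewrite det_inv SL2_det invr1. Qed.

Definition SL2_one := SL2of SL2_one_subproof.
Definition SL2_mul g h := SL2of (SL2_mul_subproof g h).
Definition SL2_inv g := SL2of (SL2_inv_subproof g).

Lemma SL2_unitmx (g : SL2 k) : SL2val g \in unitmx.
Proof. by rewrite unitmxE SL2_det unitr1. Qed.

Lemma SL2_mulA : associative SL2_mul.
Proof. by move=> g h l; apply: val_inj; rewrite /= mulmxA. Qed.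
Lemma SL2_mul1g : left_id SL2_one SL2_mul.
Proof. by move=> g; apply: val_inj; rewrite /= mul1mx. Qed.
Lemma SL2_mulg1 : right_id SL2_one SL2_mul.
Proof. by move=> g; apply: val_inj; rewrite /= mulmx1. Qed.
Lemma SL2_mulVg : left_inverse SL2_one SL2_inv SL2_mul.
Proof. by move=> g; apply: val_inj; rewrite /= mulVmx ?SL2_unitmx. Qed.
Lemma SL2_mulgV : right_inverse SL2_one SL2_inv SL2_mul.
Proof. by move=> g; apply: val_inj; rewrite /= mulmxV ?SL2_unitmx. Qed.

HB.instance Definition _ := isGroup.Build (SL2 k)
  SL2_mulA SL2_mul1g SL2_mulg1 SL2_mulVg SL2_mulgV.

(* g sends the j-th basis vector 'X_j of the standard representation to
   \sum_i g i j *: 'X_i, the j-th column of g. *)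
Definition SL2_vars (g : SL2 k) : 2.-tuple {mpoly k[2]} :=
  [tuple \sum_i g i j *: 'X_i | j < 2].

Lemma SL2_subst_homog m g (p : dhomog 2 k m) :
  (p : {mpoly k[2]}) \mPo SL2_vars g \is m.-homog.
Proof.
rewrite comp_mpolyE big_seq; apply: rpred_sum => u up; apply: rpredZ.
have <- : mdeg u = m by apply: (dhomog_mf (dhomog_is_dhomog p) up).
rewrite mdegE !big_ord_recl !big_ord0 /=; apply: dhomogM; last apply: dhomogM.
- rewrite -[u _ in X in _ \is X]mul1n; apply: dhomogMn; rewrite tnth_mktuple.
  by apply: rpred_sum => i _; apply: rpredZ; rewrite dhomogX /= mdeg1.
- rewrite -[u _ in X in _ \is X]mul1n; apply: dhomogMn; rewrite tnth_mktuple.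
  by apply: rpred_sum => i _; apply: rpredZ; rewrite dhomogX /= mdeg1.
- exact: dhomog1.
Qed.

(* The m-th symmetric power of the standard representation: homogeneous
   polynomials of degree m in the basis vectors 'X_0 and 'X_1. By dim_L and
   L_irreducible below, it is the irreducible module of dimension m + 1. *)
Definition L_act m (g : SL2 k) (p : dhomog 2 k m) : dhomog 2 k m :=
  DHomog (SL2_subst_homog g p).

Lemma L_act_linear m g : linear (@L_act m g).
Proof. by move=> a p q; apply: val_inj; rewrite /= linearP. Qed.

Lemma L_act1 m p : @L_act m 1%g p = p.
Proof.
apply: val_inj => /=; rewrite -[RHS]comp_mpoly_id; congr comp_mpoly.
apply: eq_from_tnth => j; rewrite !tnth_mktuple (bigD1 j) //= big1 => [|i ij].
  by rewrite mxE eqxx scale1r addr0.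
by rewrite mxE (negPf ij) scale0r.
Qed.

Lemma L_actM m g h p : @L_act m (g * h)%g p = L_act g (L_act h p).
Proof.
apply: val_inj => /=; rewrite (comp_mpolyEX _ (SL2_vars h)) linear_sum /=.
rewrite comp_mpolyEX; apply: eq_bigr => u _; rewrite linearZ /=; congr (_ *: _).
rewrite !comp_mpolyX rmorph_prod; apply: eq_bigr => j _; rewrite rmorphXn /=.
congr (_ ^+ _); rewrite !tnth_mktuple linear_sum /=.
under [RHS]eq_bigr => l _.
  rewrite linearZ /= comp_mpolyXU -tnth_nth tnth_mktuple scaler_sumr.
  over.
rewrite exchange_big /=; apply: eq_bigr => i _.
rewrite mxE scaler_suml; apply: eq_bigr => l _.
by rewrite scalerA mulrC.
Qed.

Definition L m : rep k (SL2 k) :=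
  Rep (@L_act_linear m) (@L_act1 m) (@L_actM m).

End SL2Group.

Lemma dim_L (k : fieldType) m : \dim {: dhomog 2 k m} = m.+1.
Proof. by rewrite dimvf /dim /= addn1 binSn. Qed.

Section Irreducibility.
Variable k : fieldType.
Hypothesis char0 : [pchar k] =i pred0.

Lemma natr_neq0 d : (d.+1%:R : k) != 0.
Proof. by rewrite ((pcharf0P k).1 char0). Qed.

Lemma natr_inj (i j : nat) : i%:R = j%:R :> k -> i = j.
Proof.
wlog ij : i j / (i <= j)%N => [H e|].
  by case/orP: (leq_total i j) => l; [exact: H|symmetry; exact: H].
rewrite -(subnKC ij) natrD; case: (j - i)%N => [|d]; first by rewrite addn0.
by move/eqP; rewrite -subr_eq0 opprD addNKr oppr_eq0 (negPf (natr_neq0 d)).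
Qed.

Lemma coefs_closed (V : lmodType k) (P : V -> Prop) N (v : 'I_N -> V) :
  (forall a x y, P x -> P y -> P (a *: x + y)) -> P 0 ->
  (forall s : k, P (\sum_(j < N) s ^+ j *: v j)) -> forall j, P (v j).
Proof.
move=> PD P0 Ps j; pose M := (Vandermonde N (\row_(i < N) (i%:R : k)))^T.
have Mu : M \in unitmx.
  rewrite unitmx_tr unitmxE det_Vandermonde unitfE.
  apply/prodf_neq0 => i _; apply/prodf_neq0 => l il.
  rewrite !mxE subr_eq0; apply/eqP => /natr_inj e.
  by move: il; rewrite e ltnn.
have -> : v j = \sum_(i < N) invmx M j i *: \sum_(l < N) (i%:R : k) ^+ l *: v l.
  under eq_bigr => i _ do rewrite scaler_sumr.
  rewrite exchange_big /= (bigD1 j) //= [X in _ + X]big1 => [|l lj].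
    under eq_bigr => i _ do rewrite scalerA.
    rewrite -scaler_suml addr0 -[LHS]scale1r; congr (_ *: _).
    have := congr1 (fun A : 'M_N => A j j) (mulVmx Mu).
    rewrite !mxE eqxx mulr1n => e; rewrite -[LHS]e.
    by apply: eq_bigr => i _; rewrite !mxE.
  under eq_bigr => i _ do rewrite scalerA.
  rewrite -scaler_suml -[RHS](scale0r (v l)); congr (_ *: _).
  have := congr1 (fun A : 'M_N => A j l) (mulVmx Mu).
  rewrite !mxE eq_sym (negPf lj) mulr0n => e; rewrite -[RHS]e.
  by apply: eq_bigr => i _; rewrite !mxE.
by elim/big_rec: _ => // i y _ Py; apply: PD.
Qed.

Let det2 (A : 'M[k]_2) : \det A = A 0 0 * A 1 1 - A 0 1 * A 1 0.
Proof.
rewrite (expand_det_row _ 0) !big_ord_recl big_ord0 addr0 /cofactor !det_mx11.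
rewrite !mxE /= /bump /= expr0 expr1 mul1r mulN1r mulrN.
by congr (_ * A _ _ - A _ _ * A _ _); exact: val_inj.
Qed.

Lemma SL2_upper_subproof (s : k) :
  \det (\matrix_(i < 2, j < 2) if i == j then 1 else if i == 0 then s else 0) == 1.
Proof.
by rewrite det2 !mxE /= mulr1 mulr0 subr0.
Qed.
Lemma SL2_lower_subproof (s : k) :
  \det (\matrix_(i < 2, j < 2) if i == j then 1 else if i == 0 then 0 else s) == 1.
Proof.
by rewrite det2 !mxE /= mulr1 mul0r subr0.
Qed.

Let x0 : {mpoly k[2]} := 'X_0.
Let x1 : {mpoly k[2]} := 'X_1.

Let vars_upper s : SL2_vars (SL2of (SL2_upper_subproof s))
  = [tuple of [:: x0; s *: x0 + x1]].
Proof.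
apply: eq_from_tnth => j; rewrite tnth_mktuple !big_ord_recl big_ord0 addr0.
rewrite (tnth_nth 0) !mxE; case: j => -[|[|//]] lj; rewrite /= ?scale1r ?scale0r.
  by rewrite addr0; congr mpolyX; congr mnm1; exact: val_inj.
by congr (_ *: mpolyX _ _ + mpolyX _ _); congr mnm1; exact: val_inj.
Qed.

Let vars_lower s : SL2_vars (SL2of (SL2_lower_subproof s))
  = [tuple of [:: x0 + s *: x1; x1]].
Proof.
apply: eq_from_tnth => j; rewrite tnth_mktuple !big_ord_recl big_ord0 addr0.
rewrite (tnth_nth 0) !mxE; case: j => -[|[|//]] lj; rewrite /= ?scale1r ?scale0r.
  by congr (mpolyX _ _ + _ *: mpolyX _ _); congr mnm1; exact: val_inj.
by rewrite add0r; congr mpolyX; congr mnm1; exact: val_inj.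
Qed.

Let subst_upper s a b :
  (x0 ^+ a * x1 ^+ b) \mPo SL2_vars (SL2of (SL2_upper_subproof s)) =
  x0 ^+ a * (s *: x0 + x1) ^+ b.
Proof. by rewrite vars_upper rmorphM !rmorphXn /= !comp_mpolyXU. Qed.

Let subst_lower s a b :
  (x0 ^+ a * x1 ^+ b) \mPo SL2_vars (SL2of (SL2_lower_subproof s)) =
  (x0 + s *: x1) ^+ a * x1 ^+ b.
Proof. by rewrite vars_lower rmorphM !rmorphXn /= !comp_mpolyXU. Qed.

Let monomialE a b : x0 ^+ a * x1 ^+ b = 'X_[(U_(0%R) *+ a + U_(1%R) *+ b)%MM].
Proof. by rewrite mpolyXD !mpolyXn. Qed.

Lemma L_monomial_homog m (i : 'I_m.+1) : x0 ^+ (m - i) * x1 ^+ i \is m.-homog.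
Proof.
rewrite monomialE dhomogX /= mdegD !mdegMn !mdeg1 !mul1n subnK //.
by rewrite -ltnS.
Qed.

Definition L_monomial m (i : 'I_m.+1) : dhomog 2 k m :=
  DHomog (L_monomial_homog i).

Lemma L_monomial_span m (p : dhomog 2 k m) :
  exists c : 'I_m.+1 -> k, p = \sum_i c i *: L_monomial i.
Proof.
suff [c cE] : exists c : 'I_m.+1 -> k,
    (p : {mpoly k[2]}) = \sum_i c i *: (x0 ^+ (m - i) * x1 ^+ i).
  exists c; apply: val_inj; rewrite /= cE raddf_sum /=.
  by apply: eq_bigr.
rewrite [X in exists c, X = _]mpolyE big_seq.
elim/big_rec: _ => [|u q up [c ->]].
  by exists (fun=> 0); rewrite big1 // => i _; rewrite scale0r.
have um : mdeg u = m by apply: (dhomog_mf (dhomog_is_dhomog p) up).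
have u1m : (u 1%R < m.+1)%N.
  by rewrite ltnS -um mdegE (bigD1 1%R) //= leq_addr.
exists (fun i => (if i == Ordinal u1m then p@_u else 0) + c i).
under [RHS]eq_bigr => i _ do rewrite scalerDl.
rewrite big_split /=; congr (_ + _).
rewrite (bigD1 (Ordinal u1m)) //= eqxx big1 => [|i /negPf ->]; last first.
  by rewrite scale0r.
rewrite addr0; congr (_ *: _); rewrite monomialE; congr mpolyX.
apply/mnmP => j; rewrite mnmDE !mulmnE !mnm1E -um mdegE !big_ord_recl big_ord0.
have -> : lift ord0 ord0 = 1 :> 'I_2 by exact: val_inj.
rewrite addn0 addnK; case: j => -[|[|//]] lj.
  by rewrite (_ : Ordinal lj = 0) ?eqxx /= ?mul1n ?mul0n ?addn0 //; exact: val_inj.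
by rewrite (_ : Ordinal lj = 1) ?eqxx /= ?mul1n ?mul0n ?add0n //; exact: val_inj.
Qed.

Lemma L_irreducible m : irreducible (L k m).
Proof.
split.
  exists (L_monomial ord0); apply/eqP => /(congr1 val) /=.
  rewrite monomialE; set u := (X in 'X_[X]) => /(congr1 (mcoeff u)) /eqP.
  by rewrite mcoeffX eqxx mcoeff0 oner_eq0.
move=> P PD Pact [p Pp p0].
have P0 : P 0 by have := PD (-1) p p Pp Pp; rewrite scaleN1r addNr.
have Psum (I : finType) (c : I -> k) (v : I -> L k m) :
    (forall i, P (v i)) -> P (\sum_i c i *: v i).
  by move=> Pv; elim/big_rec: _ => // i y _ Py; apply: PD.
have PZ a x : P x -> P (a *: x) by move=> Px; rewrite -[_ *: _]addr0; exact: PD.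
have [c pE] := L_monomial_span p.
have [i ci] : exists i, c i != 0.
  apply/existsP; apply: contraNT p0 => /existsPn c0; rewrite pE big1 // => i _.
  by move: (c0 i); rewrite negbK => /eqP ->; rewrite scale0r.
case: (@arg_maxnP _ i (fun j => c j != 0) val ci) => {ci} j cj jmax.
have Ptop : P (L_monomial ord0).
  pose w (l : 'I_m.+1) : dhomog 2 k m :=
    \sum_(i < m.+1) (c i *+ 'C(i, l)) *: L_monomial (inord (i - l)).
  have wE : w j = c j *: L_monomial ord0.
    rewrite /w (bigD1 j) //= big1 => [|l lj]; last first.
      have [lj'|jl] := ltnP l j; first by rewrite bin_small ?mulr0n ?scale0r.
      have [->|/jmax lej] := eqVneq (c l) 0; first by rewrite mul0rn scale0r.
      by case/eqP: lj; apply: val_inj; apply/eqP; rewrite eqn_leq jl andbT.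
    rewrite binn addr0 subnn; congr (_ *: L_monomial _).
    by apply: val_inj; rewrite /= inordK.
  suff : P (w j).
    by move/(PZ (c j)^-1); rewrite wE scalerA mulVf // scale1r.
  apply: coefs_closed => // s.
  rewrite (_ : \sum_(l < _) _ = rep_act (SL2of (SL2_upper_subproof s)) p);
    first exact: Pact.
  apply: val_inj; rewrite /= pE !raddf_sum /=.
  under [RHS]eq_bigr => i' _ do
    rewrite comp_mpolyZ subst_upper [_ *: _ + _]addrC exprDn.
  under eq_bigr => l _ do rewrite /w raddf_sum /= scaler_sumr.
  rewrite exchange_big /=; apply: eq_bigr => i' _.
  rewrite (big_ord_widen m.+1
    (fun l => x1 ^+ (i' - l) * (s *: x0) ^+ l *+ 'C(i', l))) //.
  rewrite [in RHS]big_mkcond mulr_sumr scaler_sumr; apply: eq_bigr => l _.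
  rewrite ltnS; case: leqP => [li|il]; last first.
    by rewrite bin_small // mulr0n scale0r scaler0 mulr0 scaler0.
  rewrite inordK; last by rewrite ltnS (leq_trans (leq_subr _ _)) // -ltnS.
  have im : (i' <= m)%N by rewrite -ltnS.
  rewrite subnBA // addnC -addnBA // addnC exprD exprZn -scalerAr -scaler_nat.
  rewrite -[c i' *+ _]mulr_natr !scalerA -!scalerAr !scalerA.
  congr (_ *: _); first by rewrite mulrC -!mulrA [_ * s ^+ l]mulrC.
  by rewrite [x1 ^+ _ * _]mulrC mulrA.
have Pmon l : P (L_monomial l).
  pose w (l : 'I_m.+1) : dhomog 2 k m := ('C(m, l)%:R : k) *: L_monomial l.
  have Cl : ('C(m, l)%:R : k) != 0.
    by rewrite -(ltn_predK (m := 0) (n := 'C(m, l))) ?natr_neq0 // bin_gt0 -ltnS.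
  suff : P (w l).
    by move/(PZ ('C(m, l)%:R)^-1); rewrite /w scalerA mulVf // scale1r.
  apply: coefs_closed => // s.
  rewrite (_ : \sum_(l < _) _ = @rep_act _ _ (L k m)
    (SL2of (SL2_lower_subproof s)) (L_monomial ord0)); first exact: Pact.
  apply: val_inj; rewrite /= subst_lower subn0 expr0 mulr1 exprDn raddf_sum /=.
  apply: eq_bigr => i' _; rewrite !linearZ /= exprZn scalerA -scalerAr.
  by rewrite -scaler_nat scalerA mulrC.
by move=> x; have [d ->] := L_monomial_span x; exact: Psum.
Qed.
End Irreducibility.

Record compatible (k : fieldType) (A : lmodType k) (op : 'I_2 -> A -> A -> A) :
    Prop := Compatible {
  op_linear_l : forall i b, linear (fun a => op i a b);
  op_linear_r : forall i a, linear (op i a);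
  op_assoc : forall i, associative (op i);
  op_compat : forall a b c,
    op 1 (op 0 a b) c + op 0 (op 1 a b) c = op 0 a (op 1 b c) + op 1 a (op 0 b c)
}.

(* The free (non-unital) algebra on X: formal expressions modulo the congruence
   generated by the axioms of a vector space with two compatible associative
   products. *)
Section FreeAlgebra.
Variables (k : fieldType) (X : Type).
Local Open Scope quotient_scope.

Inductive term : Type :=
  | Gen of X
  | Zero
  | Add of term & term
  | Scale of k & term
  | Op of 'I_2 & term & term.

Inductive eqv : term -> term -> Prop :=
  | eqv_refl t : eqv t t
  | eqv_sym s t : eqv s t -> eqv t s
  | eqv_trans s t u : eqv s t -> eqv t u -> eqv s u
  | eqv_Add s s' t t' : eqv s s' -> eqv t t' -> eqv (Add s t) (Add s' t')
  | eqv_Scale a t t' : eqv t t' -> eqv (Scale a t) (Scale a t')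
  | eqv_Op i s s' t t' : eqv s s' -> eqv t t' -> eqv (Op i s t) (Op i s' t')
  | eqv_addA s t u : eqv (Add s (Add t u)) (Add (Add s t) u)
  | eqv_addC s t : eqv (Add s t) (Add t s)
  | eqv_add0 t : eqv (Add Zero t) t
  | eqv_addN t : eqv (Add (Scale (-1) t) t) Zero
  | eqv_scaleA a b t : eqv (Scale a (Scale b t)) (Scale (a * b) t)
  | eqv_scale1 t : eqv (Scale 1 t) t
  | eqv_scaleDr a s t : eqv (Scale a (Add s t)) (Add (Scale a s) (Scale a t))
  | eqv_scaleDl a b t : eqv (Scale (a + b) t) (Add (Scale a t) (Scale b t))
  | eqv_op_l i a s t u :
      eqv (Op i (Add (Scale a s) t) u) (Add (Scale a (Op i s u)) (Op i t u))
  | eqv_op_r i a s t u :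
      eqv (Op i u (Add (Scale a s) t)) (Add (Scale a (Op i u s)) (Op i u t))
  | eqv_opA i s t u : eqv (Op i s (Op i t u)) (Op i (Op i s t) u)
  | eqv_op_compat s t u :
      eqv (Add (Op 1 (Op 0 s t) u) (Op 0 (Op 1 s t) u))
          (Add (Op 0 s (Op 1 t u)) (Op 1 s (Op 0 t u))).

HB.instance Definition _ := gen_eqMixin term.
HB.instance Definition _ := gen_choiceMixin term.

Definition eqvb (s t : term) : bool := `[< eqv s t >].

Lemma eqvb_refl : reflexive eqvb.
Proof. by move=> t; apply/asboolP; exact: eqv_refl. Qed.
Lemma eqvb_sym : ssrbool.symmetric eqvb.
Proof. by move=> s t; apply/asboolP/asboolP; exact: eqv_sym. Qed.
Lemma eqvb_trans : transitive eqvb.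
Proof.
by move=> t s u /asboolP st /asboolP tu; apply/asboolP; exact: eqv_trans st tu.
Qed.

Canonical eqvb_equiv := EquivRel eqvb eqvb_refl eqvb_sym eqvb_trans.

Definition free_alg := {eq_quot eqvb}.

HB.instance Definition _ := EqQuotient.on free_alg.
HB.instance Definition _ := Choice.on free_alg.

Definition expr_class (t : term) : free_alg := \pi t.

Lemma free_algW (P : free_alg -> Prop) :
  (forall t, P (expr_class t)) -> forall x, P x.
Proof. exact: quotW. Qed.

Lemma free_algP (s t : term) : eqv s t <-> expr_class s = expr_class t.
Proof. by split=> [?|/eqmodP/asboolP//]; apply/eqmodP/asboolP. Qed.

Lemma eqv_repr (t : term) : eqv t (repr (expr_class t)).
Proof. by apply/free_algP; rewrite /expr_class reprK. Qed.

Definition gen (x : X) : free_alg := expr_class (Gen x).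
Definition free_zero : free_alg := expr_class Zero.
Definition free_add (x y : free_alg) := expr_class (Add (repr x) (repr y)).
Definition free_scale (a : k) (x : free_alg) := expr_class (Scale a (repr x)).
Definition free_op (i : 'I_2) (x y : free_alg) : free_alg :=
  expr_class (Op i (repr x) (repr y)).

Lemma free_addE s t :
  free_add (expr_class s) (expr_class t) = expr_class (Add s t).
Proof. by apply/free_algP; apply: eqv_Add; exact/eqv_sym/eqv_repr. Qed.
Lemma free_scaleE a t : free_scale a (expr_class t) = expr_class (Scale a t).
Proof. by apply/free_algP; apply: eqv_Scale; exact/eqv_sym/eqv_repr. Qed.
Lemma free_opE i s t :
  free_op i (expr_class s) (expr_class t) = expr_class (Op i s t).
Proof. by apply/free_algP; apply: eqv_Op; exact/eqv_sym/eqv_repr. Qed.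

Lemma free_addA : associative free_add.
Proof.
elim/free_algW=> s; elim/free_algW=> t; elim/free_algW=> u; rewrite !free_addE.
by apply/free_algP; exact: eqv_addA.
Qed.
Lemma free_addC : commutative free_add.
Proof.
elim/free_algW=> s; elim/free_algW=> t; rewrite !free_addE.
by apply/free_algP; exact: eqv_addC.
Qed.
Lemma free_add0 : left_id free_zero free_add.
Proof.
by elim/free_algW=> t; rewrite free_addE; apply/free_algP; exact: eqv_add0.
Qed.
Lemma free_addN : left_inverse free_zero (free_scale (-1)) free_add.
Proof.
elim/free_algW=> t; rewrite free_scaleE free_addE.
by apply/free_algP; exact: eqv_addN.
Qed.

HB.instance Definition _ := GRing.isZmodule.Build free_alg
  free_addA free_addC free_add0 free_addN.

Lemma free_scaleA a b x : free_scale a (free_scale b x) = free_scale (a * b) x.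
Proof.
by elim/free_algW: x => t; rewrite !free_scaleE; apply/free_algP; exact: eqv_scaleA.
Qed.
Lemma free_scale1 : left_id 1 free_scale.
Proof.
by elim/free_algW=> t; rewrite free_scaleE; apply/free_algP; exact: eqv_scale1.
Qed.
Lemma free_scaleDr : right_distributive free_scale +%R.
Proof.
move=> a; elim/free_algW=> s; elim/free_algW=> t.
rewrite -![_ + _]/(free_add _ _) !(free_scaleE, free_addE).
by apply/free_algP; exact: eqv_scaleDr.
Qed.
Lemma free_scaleDl x : {morph free_scale^~ x : a b / a + b}.
Proof.
move=> a b; elim/free_algW: x => t.
rewrite -![_ (free_scale a _) _]/(free_add _ _) !(free_scaleE, free_addE).
by apply/free_algP; exact: eqv_scaleDl.
Qed.

HB.instance Definition _ := GRing.Zmodule_isLmodule.Build k free_alg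
  free_scaleA free_scale1 free_scaleDr free_scaleDl.

Lemma free_zeroE : 0 = expr_class Zero.
Proof. by []. Qed.
Lemma free_DE s t : expr_class s + expr_class t = expr_class (Add s t).
Proof. exact: free_addE. Qed.
Lemma free_ZE a t : a *: expr_class t = expr_class (Scale a t).
Proof. exact: free_scaleE. Qed.

Lemma free_compatible : compatible free_op.
Proof.
split=> [i|i|i|].
- elim/free_algW=> u a; elim/free_algW=> s; elim/free_algW=> t.
  rewrite (free_ZE a s) (free_DE (Scale a s) t) (free_opE i _ u).
  rewrite (free_opE i s u) (free_opE i t u) (free_ZE a (Op i s u)) free_DE.
  by apply/free_algP; exact: eqv_op_l.
- elim/free_algW=> u a; elim/free_algW=> s; elim/free_algW=> t.
  rewrite (free_ZE a s) (free_DE (Scale a s) t) (free_opE i u _).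
  rewrite (free_opE i u s) (free_opE i u t) (free_ZE a (Op i u s)) free_DE.
  by apply/free_algP; exact: eqv_op_r.
- elim/free_algW=> s; elim/free_algW=> t; elim/free_algW=> u.
  rewrite (free_opE i t u) (free_opE i s t) (free_opE i s _) (free_opE i _ u).
  by apply/free_algP; exact: eqv_opA.
- elim/free_algW=> s; elim/free_algW=> t; elim/free_algW=> u.
  rewrite (free_opE 0 s t) (free_opE 1 s t) (free_opE 0 t u) (free_opE 1 t u).
  rewrite (free_opE 0 _ u) (free_opE 1 _ u) (free_opE 0 s _) (free_opE 1 s _).
  by rewrite !free_DE; apply/free_algP; exact: eqv_op_compat.
Qed.

Section UniversalProperty.
Variables (A : lmodType k) (op : 'I_2 -> A -> A -> A) (f : X -> A).

Fixpoint eval (t : term) : A :=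
  match t with
  | Gen x => f x
  | Zero => 0
  | Add s t => eval s + eval t
  | Scale a t => a *: eval t
  | Op i s t => op i (eval s) (eval t)
  end.

Definition free_lift (x : free_alg) : A := eval (repr x).

Hypothesis opP : compatible op.

Lemma eval_eqv s t : eqv s t -> eval s = eval t.
Proof.
elim=> //= [? ? ? _ -> _ -> //|? ? ? ? _ -> _ -> //|? ? ? _ -> //
  |? ? ? ? ? _ -> _ -> //|? ? ?|? ?|?|?|? ? ?|?|? ? ?|? ? ?|? ? ? ? ?|? ? ? ? ?
  |? ? ? ?|? ? ?].
- by rewrite addrA.
- by rewrite addrC.
- by rewrite add0r.
- by rewrite scaleN1r addNr.
- by rewrite scalerA.
- by rewrite scale1r.
- by rewrite scalerDr.
- by rewrite scalerDl.
- exact: (op_linear_l opP).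
- exact: (op_linear_r opP).
- exact: (op_assoc opP).
- exact: (op_compat opP).
Qed.

Lemma free_liftE t : free_lift (expr_class t) = eval t.
Proof. by apply/eval_eqv/eqv_sym/eqv_repr. Qed.

Lemma free_lift_gen x : free_lift (gen x) = f x.
Proof. exact: free_liftE. Qed.

Lemma free_lift_linear : linear free_lift.
Proof.
by move=> a; elim/free_algW=> s; elim/free_algW=> t; rewrite free_ZE free_DE !free_liftE.
Qed.

Lemma free_lift_op i x y : free_lift (free_op i x y) = op i (free_lift x) (free_lift y).
Proof. by elim/free_algW: x => s; elim/free_algW: y => t; rewrite free_opE !free_liftE. Qed.

Lemma free_lift_unique (h : free_alg -> A) : linear h ->
  (forall x, h (gen x) = f x) ->
  (forall i x y, h (free_op i x y) = op i (h x) (h y)) -> h =1 free_lift.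
Proof.
move=> hl hg ho; elim/free_algW=> t; rewrite free_liftE.
have h0 : h 0 = 0 by have := hl (-1) 0 0; rewrite !scaleN1r !addNr.
elim: t => [x|||a t IH|i s IHs t IHt] /=.
- by rewrite -hg.
- by rewrite -free_zeroE.
- move=> s IHs t IHt; rewrite -free_DE -[X in h (X + _)]scale1r hl scale1r.
  by rewrite IHs IHt.
- by rewrite -free_ZE -[X in h X]addr0 hl h0 addr0 IH.
- by rewrite -free_opE ho IHs IHt.
Qed.
End UniversalProperty.

(* monomial s x: x is a monomial in which the generators s occur, listed from
   left to right. *)
Inductive monomial : seq X -> free_alg -> Prop :=
  | monomial_gen x : monomial [:: x] (gen x)
  | monomial_op i s t a b : monomial s a -> monomial t b ->
      monomial (s ++ t) (free_op i a b).

End FreeAlgebra.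

Arguments gen {k X} x.
Arguments free_op {k X} i x y.

Section Twist.
Variables (k : fieldType) (A : lmodType k) (op : 'I_2 -> A -> A -> A).
Variable g : SL2 k.

(* g sends the j-th product to \sum_i g i j times the i-th product. *)
Definition twist : 'I_2 -> A -> A -> A :=
  fun j x y => \sum_i g i j *: op i x y.

Lemma twistE j x y : twist j x y = g 0 j *: op 0 x y + g 1 j *: op 1 x y.
Proof.
rewrite /twist !big_ord_recl big_ord0 addr0.
by have -> : lift ord0 ord0 = 1 :> 'I_2 by exact: val_inj.
Qed.

Lemma twist_compatible : compatible op -> compatible twist.
Proof.
move=> opP.
have op0l i l : op i 0 l = 0.
  by have := op_linear_l opP i l (-1) 0 0; rewrite !scaleN1r !addNr.
have op0r i l : op i l 0 = 0.
  by have := op_linear_r opP i l (-1) 0 0; rewrite !scaleN1r !addNr.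
have opl i l c d a b : op i (c *: a + d *: b) l = c *: op i a l + d *: op i b l.
  rewrite (op_linear_l opP) -{1}[d *: b]addr0.
  by rewrite (op_linear_l opP) op0l addr0.
have opr i l c d a b : op i l (c *: a + d *: b) = c *: op i l a + d *: op i l b.
  rewrite (op_linear_r opP) -{1}[d *: b]addr0.
  by rewrite (op_linear_r opP) op0r addr0.
have opS a b c : op 1 (op 0 a b) c =
    op 0 a (op 1 b c) + op 1 a (op 0 b c) - op 0 (op 1 a b) c.
  by rewrite -(op_compat opP) addrK.
have expandl i j a b c : twist i (twist j a b) c =
    (g 0 i * g 0 j) *: op 0 (op 0 a b) c + (g 0 i * g 1 j) *: op 0 (op 1 a b) c +
    ((g 1 i * g 0 j) *: op 1 (op 0 a b) c + (g 1 i * g 1 j) *: op 1 (op 1 a b) c).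
  by rewrite !twistE !opl !scalerDr !scalerA.
have expandr i j a b c : twist i a (twist j b c) =
    (g 0 i * g 0 j) *: op 0 a (op 0 b c) + (g 0 i * g 1 j) *: op 0 a (op 1 b c) +
    ((g 1 i * g 0 j) *: op 1 a (op 0 b c) + (g 1 i * g 1 j) *: op 1 a (op 1 b c)).
  by rewrite !twistE !opr !scalerDr !scalerA.
split=> [i b c x y|i b c x y|i a b c|a b c].
- rewrite !twistE !(op_linear_l opP) !scalerDr !scalerA addrACA.
  by rewrite ![_ * c]mulrC.
- rewrite !twistE !(op_linear_r opP) !scalerDr !scalerA addrACA.
  by rewrite ![_ * c]mulrC.
- rewrite expandl expandr !opS !(op_assoc opP) (mulrC (g 1 i) (g 0 i)).
  rewrite -!addrA; congr (_ + _); rewrite !addrA; congr (_ + _).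
  by rewrite -!scalerDr; congr (_ *: _); rewrite [RHS]addrC subrK.
- have collect (p q r t : k) (u v w z : A) :
      p *: u + q *: v + (r *: w + t *: z) + (p *: u + r *: v + (q *: w + t *: z))
      = (p *: u + p *: u) + (q + r) *: (w + v) + (t *: z + t *: z).
    rewrite addrACA [X in X + _ = _]addrACA [X in _ + X = _]addrACA.
    rewrite -(scalerDl v q r) -(scalerDl w r q) scalerDr [r + q]addrC.
    by rewrite [(q + r) *: w + _ in RHS]addrC !addrA.
  rewrite !expandl !expandr (mulrC (g 0 1) (g 0 0)) (mulrC (g 0 1) (g 1 0)).
  rewrite (mulrC (g 1 1) (g 0 0)) (mulrC (g 1 1) (g 1 0)) collect.
  rewrite [RHS]addrC [RHS]collect (op_compat opP) !(op_assoc opP).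
  by rewrite [op 1 a (op 0 b c) + _]addrC.
Qed.
End Twist.

Definition lin_span (k : fieldType) (V : lmodType k) (P : V -> Prop) (x : V) : Prop :=
  exists (m : nat) (c : 'I_m -> k) (v : 'I_m -> V),
    (forall i, P (v i)) /\ x = \sum_i c i *: v i.

Section Span.
Variables (k : fieldType) (V : lmodType k).
Implicit Types P Q : V -> Prop.

Lemma lin_span_gen P x : P x -> lin_span P x.
Proof.
move=> Px; exists 1, (fun=> 1), (fun=> x).
by split=> //; rewrite big_ord1 scale1r.
Qed.

Lemma lin_span0 P : lin_span P 0.
Proof. by exists 0, (fun=> 0), (fun=> 0); rewrite big_ord0; split=> // -[]. Qed.

Lemma lin_spanP P a x y : lin_span P x -> lin_span P y -> lin_span P (a *: x + y).
Proof.
move=> [m [c [v [Pv ->]]]] [m' [c' [v' [Pv' ->]]]].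
exists (m + m')%N,
  (fun i => match split i with inl j => a * c j | inr j => c' j end),
  (fun i => match split i with inl j => v j | inr j => v' j end).
split=> [i|]; first by case: (split i).
rewrite big_split_ord /= scaler_sumr; congr (_ + _); apply: eq_bigr => i _.
  by rewrite -[lshift _ i]/(unsplit (inl i)) unsplitK scalerA.
by rewrite -[rshift _ i]/(unsplit (inr i)) unsplitK.
Qed.

Lemma lin_span_min P Q : Q 0 -> (forall a x y, Q x -> Q y -> Q (a *: x + y)) ->
  (forall x, P x -> Q x) -> forall x, lin_span P x -> Q x.
Proof.
move=> Q0 QD PQ x [m [c [v [Pv ->]]]].
by elim/big_rec: _ => // i y _ Qy; apply: QD => //; apply/PQ.
Qed.
End Span.

Section Component.
Variables (k : fieldType) (n : nat).
Local Notation F := (free_alg k 'I_n).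

Definition multilinear_monomial (x : F) : Prop :=
  exists2 s, monomial s x & forall i, count_mem i s = 1%N.

Definition multilinear : pred F := fun x => `[< lin_span multilinear_monomial x >].

Lemma multilinear_submod_closed : submod_closed multilinear.
Proof.
split=> [|a x y]; first exact/asboolP/lin_span0.
by rewrite !unfold_in => /asboolP ? /asboolP ?; apply/asboolP/lin_spanP.
Qed.

HB.instance Definition _ :=
  GRing.isSubmodClosed.Build k F multilinear multilinear_submod_closed.

Record As2 := As2of { As2val : F; _ : As2val \in multilinear }.

HB.instance Definition _ := [isSub for As2val].
HB.instance Definition _ := [Choice of As2 by <:].
HB.instance Definition _ := [SubChoice_isSubLmodule of As2 by <:].

(* (s, g) acts as the operad automorphism g and permutes the generators by s.
   Permutations are multiplied from left to right in the library,
   (s * t) i = t (s i), so that x_i |-> x_(s^-1 i) is a left action. *)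
Definition free_act (sg : 'S_n * SL2 k) : F -> F :=
  free_lift (twist free_op sg.2) (fun i => gen (sg.1^-1%g i)).

Lemma free_act_linear sg : linear (free_act sg).
Proof. exact/free_lift_linear/twist_compatible/free_compatible. Qed.

Lemma free_act_gen sg i : free_act sg (gen i) = gen (sg.1^-1%g i).
Proof. exact/free_lift_gen/twist_compatible/free_compatible. Qed.

Lemma free_act_op sg j x y : free_act sg (free_op j x y) =
  \sum_i sg.2 i j *: free_op i (free_act sg x) (free_act sg y).
Proof. exact/free_lift_op/twist_compatible/free_compatible. Qed.

Lemma free_act_sum sg (I : finType) (c : I -> k) (v : I -> F) :
  free_act sg (\sum_i c i *: v i) = \sum_i c i *: free_act sg (v i).
Proof.
elim/big_rec2: _ => [|i y z _ <-]; last exact: free_act_linear.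
by have := free_act_linear sg (-1) 0 0; rewrite !scaleN1r !addNr.
Qed.

Lemma free_act1 x : free_act 1%g x = x.
Proof.
symmetry; move: x; apply: (@free_lift_unique _ _ _ _ _ _ id) => //=.
- exact/twist_compatible/free_compatible.
- by move=> i; rewrite invg1 perm1.
- move=> j a b; rewrite /twist (bigD1 j) //= big1 => [|i ij].
    by rewrite mxE eqxx scale1r addr0.
  by rewrite mxE (negPf ij) scale0r.
Qed.

Lemma free_actM sg th x : free_act (sg * th)%g x = free_act sg (free_act th x).
Proof.
symmetry; move: x.
apply: (@free_lift_unique _ _ _ _ _ _ (free_act sg \o free_act th)) => /=.
- exact/twist_compatible/free_compatible.
- by move=> a x y /=; rewrite !free_act_linear.
- by move=> i; rewrite !free_act_gen invMg permM.
- move=> j x y; rewrite [free_act th _]free_act_op free_act_sum.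
  under eq_bigr => i _ do rewrite free_act_op scaler_sumr.
  rewrite exchange_big /=; apply: eq_bigr => l _.
  rewrite mxE scaler_suml; apply: eq_bigr => i _.
  by rewrite scalerA mulrC.
Qed.

Lemma lin_span_monomial_act (sg : 'S_n * SL2 k) s (x : F) : monomial s x ->
  lin_span (monomial (map (fun i => sg.1^-1%g i) s)) (free_act sg x).
Proof.
elim=> [i|j {}s t a b _ IHa _ IHb] /=.
  by rewrite free_act_gen; apply/lin_span_gen/monomial_gen.
rewrite free_act_op; elim/big_rec: _ => [|i y _ IHy]; first exact: lin_span0.
apply: lin_spanP => //; rewrite map_cat.
move: (free_act sg a) IHa => {}a IHa; move: (free_act sg b) IHb => {}b IHb.
have opl : linear (fun c : F => free_op i c b).
  exact: (op_linear_l (free_compatible k 'I_n)).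
apply: (@lin_span_min _ _ _ (fun c => lin_span _ (free_op i c b))) IHa => /=.
- by have := opl (-1) 0 0; rewrite !scaleN1r !addNr => ->; exact: lin_span0.
- by move=> c x1 x2 h1 h2; rewrite opl; exact: lin_spanP.
move=> {opl} {}a Ha; have opr : linear (free_op i a).
  exact: (op_linear_r (free_compatible k 'I_n)).
apply: (@lin_span_min _ _ _ (fun c => lin_span _ (free_op i a c))) IHb => /=.
- by have := opr (-1) 0 0; rewrite !scaleN1r !addNr => ->; exact: lin_span0.
- by move=> c x1 x2 h1 h2; rewrite opr; exact: lin_spanP.
by move=> {}b Hb; apply/lin_span_gen/monomial_op.
Qed.

Lemma free_act_multilinear sg x :
  x \in multilinear -> free_act sg x \in multilinear.
Proof.
rewrite !unfold_in => /asboolP Hx; apply/asboolP.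
apply: (@lin_span_min _ _ _ (fun c => lin_span _ (free_act sg c))) Hx => /=.
- have := free_act_linear sg (-1) 0 0; rewrite !scaleN1r !addNr => ->.
  exact: lin_span0.
- by move=> c x1 x2 h1 h2; rewrite free_act_linear; exact: lin_spanP.
move=> {}x [s Hs sn]; apply: lin_span_min (lin_span_monomial_act sg Hs).
- exact: lin_span0.
- by move=> *; exact: lin_spanP.
move=> y Hy; apply: lin_span_gen; exists (map (fun i => sg.1^-1%g i) s) => // i.
rewrite -(sn (sg.1 i)) count_map; apply: eq_count => j /=.
by rewrite (canF_eq (permK _)) invgK.
Qed.

Definition As2_act (sg : 'S_n * SL2 k) (x : As2) : As2 :=
  As2of (free_act_multilinear sg (valP x)).

Lemma As2_act_linear sg : linear (As2_act sg).
Proof. by move=> a x y; apply: val_inj; rewrite /= free_act_linear. Qed.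
Lemma As2_act1 x : As2_act 1%g x = x.
Proof. by apply: val_inj; rewrite /= free_act1. Qed.
Lemma As2_actM sg th x : As2_act (sg * th)%g x = As2_act sg (As2_act th x).
Proof. by apply: val_inj; rewrite /= free_actM. Qed.

Definition As2_rep : rep k ('S_n * SL2 k)%type :=
  Rep As2_act_linear As2_act1 As2_actM.

End Component.

Definition catalan (n : nat) : nat := ('C(n.*2, n) %/ n.+1)%N.

Definition narayana (n k : nat) : nat := ('C(n, k) * 'C(n, k.+1) %/ n)%N.

(* N_(n, k) - N_(n, k - 1), where N_(n, -1) = 0. *)
Definition L_mult (n k : nat) : nat :=
  (narayana n k - (if k is j.+1 then narayana n j else 0))%N.

(* The divisions and the subtractions used above are exact. *)
Lemma catalanE n : (n.+1 * catalan n = 'C(n.*2, n))%N.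
Proof.
rewrite /catalan mulnC divnK //.
case: n => // n; rewrite -(Gauss_dvdr _ (coprimeSn n.+1)); apply/dvdnP.
exists 'C(n.+1.*2, n); rewrite mul_bin_left mulnC; congr (_ * _)%N.
by rewrite doubleS -addnn -!addnS addKn.
Qed.

Lemma narayanaE n k : (0 < n)%N -> (n * narayana n k = 'C(n, k) * 'C(n, k.+1))%N.
Proof.
move=> n_gt0; rewrite /narayana mulnC divnK //.
have [nk|kn] := ltnP n k; first by rewrite bin_small.
set p := ('C(n, k) * _)%N.
have d1 : (n %| k.+1 * p)%N.
  by rewrite /p mulnCA -mul_bin_diag mulnCA dvdn_mulr.
have d2 : (n %| (n - k) * p)%N.
  by rewrite /p mulnA -mul_bin_down -mulnA dvdn_mulr.
have d3 : (n %| k * p)%N.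
  by rewrite -(dvdn_addr _ d2) -mulnDl subnK // dvdn_mulr.
by rewrite -(dvdn_addr _ d3) addnC -mulSn.
Qed.

Lemma narayana_le n j : (j.+1.*2 < n)%N -> (narayana n j <= narayana n j.+1)%N.
Proof.
move=> jn; apply: leq_div2r; rewrite mulnC leq_mul2l; apply/orP; right.
have e1 := mul_bin_left n j; have e2 := mul_bin_left n j.+1.
have e : (j.+2 * j.+1 * 'C(n, j.+2) = (n - j.+1) * (n - j) * 'C(n, j))%N.
  by rewrite mulnAC e2 -mulnA [('C(n, j.+1) * _)%N]mulnC e1 mulnA.
rewrite -(leq_pmul2l (m := (j.+2 * j.+1)%N)) // e leq_mul2r; apply/orP; right.
have jn' : (j.+1 + j.+1 < n)%N by rewrite addnn.
apply: leq_mul; first by rewrite ltn_subRL.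
by rewrite ltn_subRL; apply: ltn_trans jn'; rewrite addSn addnS ltnS leqW.
Qed.

(* Main.v *)
Require Import Defs.
From HB Require Import structures.
From mathcomp Require Import all_boot all_order all_fingroup all_algebra.
From mathcomp Require Import boolp mpoly.
From mathcomp Require Import ring zify.
From mathcomp Require finmap monalg.

Set Implicit Arguments.
Unset Strict Implicit.
Unset Printing Implicit Defensive.
Import GRing.Theory.
Local Open Scope ring_scope.

(** Write a_i b for the i-th product of a and b, and w(i, j) for the symplectic
   form with w(0, 1) = 1. That all linear combinations of the two products are
   associative means that (a_i b)_j c - a_i (b_j c) is alternating in (i, j),
   hence equal to w(i, j) K(a, b, c) for a trilinear operation K ([cross_assoc]).
   Two consequences of the axioms,

     (a_j b)_i c    = a_j (b_i c) + w(j, i) K(a, b, c),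
     K(a, b, c)_i d = K(a, b, c_i d) - K(a, b_i c, d),

   rewrite every product into trees built from letters x by t |-> x_i t and
   (s, t) |-> K(x, s, t). So these labelled unary-binary trees span the free
   algebra ([tree_span_op]). They are linearly independent because, conversely,
   the same two formulas define two compatible products on the vector space with
   basis the trees ([tree_compatible]): both associativity and compatibility
   follow by induction on the leftmost tree.

   This basis shows the module structure. In prefix order the letters of a tree
   form a word and the labels of its unary nodes form another. The multilinear
   component has as basis the triples of a shape with n nodes, a permutation and
   a word of labels. An element g of SL2 acts on the span of the two products as
   on the standard module V, and K is invariant because det g = 1. Hence the
   component is kS_n (x) W, where W is the direct sum over all shapes s with n
   nodes of the tensor power of V with one factor for each unary node of s
   ([As2_tree_rep]).

   What remains is to count. The labelled shapes number [catalan n], which gives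
   the first claim. For the second, V (x) L(m) is L(m + 1) + L(m - 1), where
   L(- 1) = 0, by explicit mutually inverse maps (multiplication and contraction
   against partial derivatives). So W is a direct sum of modules L(d), with
   multiplicities that satisfy a Pascal-like recursion once shapes are replaced
   by forests. Its solution is a difference of two determinants of binomial
   coefficients, which for a single tree are Narayana numbers ([shapes_mult]). *)

(** * Isomorphisms of representations *)

Section RepIso.
Variables (k : fieldType) (G : groupType).
Implicit Types U V W : rep k G.

Lemma rep_isoI V W (f : V -> W) (f' : W -> V) :
  linear f -> cancel f f' -> cancel f' f ->
  (forall g x, f (rep_act g x) = rep_act g (f x)) -> rep_iso V W.
Proof.
move=> lf fK f'K fact.
pose F : {linear V -> W} := HB.pack f (GRing.isLinear.Build k V W *:%R f lf).
by exists F; split=> //; exists f'.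
Qed.

Lemma rep_isoE V W : rep_iso V W -> exists (f : V -> W) (f' : W -> V),
  [/\ linear f, cancel f f', cancel f' f &
      forall g x, f (rep_act g x) = rep_act g (f x)].
Proof.
by case=> f [[f' fK f'K] fact]; exists f, f'; split=> //; exact: linearP.
Qed.

Lemma rep_iso_sym V W : rep_iso V W -> rep_iso W V.
Proof.
case/rep_isoE=> f [f' [lf fK f'K fact]]; apply: (rep_isoI _ f'K fK).
  by move=> a x y; apply: (can_inj fK); rewrite lf !f'K.
by move=> g x; apply: (can_inj fK); rewrite fact !f'K.
Qed.

Lemma rep_iso_trans V U W : rep_iso U V -> rep_iso V W -> rep_iso U W.
Proof.
case/rep_isoE=> f [f' [lf fK f'K fact]].
case/rep_isoE=> h [h' [lh hK h'K hact]].
apply: (@rep_isoI _ _ (h \o f) (f' \o h')).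
- by move=> a x y /=; rewrite lf lh.
- exact: can_comp.
- exact: can_comp.
- by move=> g x /=; rewrite fact hact.
Qed.

Lemma rep_act_sum V g (I : finType) (P : pred I) (v : I -> V) :
  rep_act g (\sum_(i | P i) v i) = \sum_(i | P i) rep_act g (v i).
Proof.
have g0 : rep_act g (0 : V) = 0.
  by have := rep_act_linear g (-1) 0 (0 : V); rewrite !scaleN1r !addNr.
elim/big_rec2: _ => // i y x _ <-.
by have := rep_act_linear g 1 (v i) x; rewrite !scale1r.
Qed.

Lemma rep_actZ V g a (x : V) : rep_act g (a *: x) = a *: rep_act g x.
Proof.
have := rep_act_linear g a x 0; rewrite addr0 => ->.
have := rep_act_linear g (-1) 0 (0 : V); rewrite !scaleN1r !addNr => ->.
by rewrite addr0.
Qed.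

Section DirectSums.
Variable I : finType.

Lemma dsum_iso (V W : I -> rep k G) :
  (forall i, rep_iso (V i) (W i)) -> rep_iso (dsum V) (dsum W).
Proof.
move=> VW.
have ex i : exists f : (V i -> W i) * (W i -> V i),
    [/\ linear f.1, cancel f.1 f.2, cancel f.2 f.1 &
        forall g x, f.1 (rep_act g x) = rep_act g (f.1 x)].
  by have [f [f' fP]] := rep_isoE (VW i); exists (f, f').
pose f i := projT1 (cid (ex i)); have fP i := projT2 (cid (ex i)).
apply: (@rep_isoI (dsum V) (dsum W)
  (fun x => finfun (fun i => (f i).1 (x i)) : dsum W)
  (fun x => finfun (fun i => (f i).2 (x i)) : dsum V)).
- by move=> a x y; apply/ffunP => i; rewrite !ffunE; have [/= -> _ _ _] := fP i.
- by move=> x; apply/ffunP => i; rewrite !ffunE; have [/= _ -> _ _] := fP i.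
- by move=> x; apply/ffunP => i; rewrite !ffunE; have [/= _ _ -> _] := fP i.
- by move=> g x; apply/ffunP => i; rewrite !ffunE; have [/= _ _ _ ->] := fP i.
Qed.

(** The inverse must move a vector from V (h (h' i)) to V i, whence the casts. *)
Lemma dsum_reindex (J : finType) (h : J -> I) (V : I -> rep k G) :
  bijective h -> rep_iso (dsum V) (dsum (fun j => V (h j))).
Proof.
case=> h' hK h'K.
pose back (x : dsum (fun j => V (h j))) : dsum V :=
  finfun (fun i => ecast i (V i) (h'K i) (x (h' i))).
have castE j (y : forall j, V (h j)) (e : h (h' (h j)) = h j) :
    ecast i (V i) e (y (h' (h j))) = y j.
  by move: e; rewrite hK => e; rewrite (eq_axiomK e).
have castD i i' (e : i' = i) a (x y : V i') :
    ecast i (V i) e (a *: x + y) = a *: ecast i (V i) e x + ecast i (V i) e y.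
  by case: _ / e.
have cast_act i i' (e : i' = i) g (x : V i') :
    ecast i (V i) e (rep_act g x) = rep_act g (ecast i (V i) e x).
  by case: _ / e.
have castK i i' (e : i' = i) (x : forall i, V i) : ecast i (V i) e (x i') = x i.
  by case: _ / e.
apply: rep_iso_sym; apply: (@rep_isoI (dsum (fun j => V (h j))) (dsum V) back
  (fun x => finfun (fun j => x (h j)) : dsum (fun j => V (h j)))).
- by move=> a x y; apply/ffunP => i; rewrite !ffunE castD.
- by move=> x; apply/ffunP => j; rewrite !ffunE castE.
- by move=> x; apply/ffunP => i; rewrite !ffunE castK.
- by move=> g x; apply/ffunP => i; rewrite !ffunE cast_act.
Qed.

Lemma dsum_flatten (J : I -> finType) (V : forall i, J i -> rep k G) :
  rep_iso (dsum (fun i => dsum (V i)))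
          (dsum (fun p : {i : I & J i} => V (tag p) (tagged p))).
Proof.
apply: (@rep_isoI (dsum (fun i => dsum (V i)))
  (dsum (fun p : {i : I & J i} => V (tag p) (tagged p)))
  (fun x => finfun (fun p => x (tag p) (tagged p))
     : dsum (fun p : {i : I & J i} => V (tag p) (tagged p)))
  (fun x => finfun (fun i => finfun (fun j => x (Tagged J j)) : dsum (V i))
     : dsum (fun i => dsum (V i)))).
- by move=> a x y; apply/ffunP => p; rewrite !ffunE.
- by move=> x; apply/ffunP => i; apply/ffunP => j; rewrite !ffunE.
- by move=> x; apply/ffunP => -[i j]; rewrite !ffunE.
- by move=> g x; apply/ffunP => p; rewrite !ffunE.
Qed.

End DirectSums.
End RepIso.

Lemma regular_tensor_iso (k : fieldType) (G : finGroupType) (H : groupType)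
    (V W : rep k H) :
  rep_iso V W -> rep_iso (regular_tensor G V) (regular_tensor G W).
Proof.
case/rep_isoE=> f [f' [lf fK f'K fact]].
apply: (@rep_isoI _ _ (regular_tensor G V) (regular_tensor G W)
  (fun x : {ffun G -> V} => [ffun s => f (x s)] : {ffun G -> W})
  (fun x : {ffun G -> W} => [ffun s => f' (x s)] : {ffun G -> V})).
- by move=> a x y; apply/ffunP => i; rewrite !ffunE lf.
- by move=> x; apply/ffunP => i; rewrite !ffunE fK.
- by move=> x; apply/ffunP => i; rewrite !ffunE f'K.
- by move=> g x; apply/ffunP => i; rewrite !ffunE fact.
Qed.

Lemma resl_iso (k : fieldType) (G H : groupType) (V W : rep k (G * H)%type) :
  rep_iso V W -> rep_iso (resl V) (resl W).
Proof.
case/rep_isoE=> f [f' [lf fK f'K fact]].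
by apply: (@rep_isoI _ _ (resl V) (resl W) f f') => // g x; exact: fact.
Qed.

(** * Sums of the modules L(m) *)

Section Decomposition.
Variable k : fieldType.
Local Notation SL2 := (SL2 k).

Definition Lsum (I : finType) (m : I -> nat) : rep k SL2 :=
  dsum (fun i => L k (m i)).

(** For such W the function c is the multiplicity of each L(d). *)
Definition decomposes (W : rep k SL2) (c : nat -> nat) : Prop :=
  exists (I : finType) (m : I -> nat),
    rep_iso W (Lsum m) /\ forall d, #|[pred i | m i == d]| = c d.

(** Equal multiplicities give a bijection h between the index sets with
   m' = m \o h, because the two lists of values are permutations of each other. *)
Lemma Lsum_iso (I J : finType) (m : I -> nat) (m' : J -> nat) :
  (forall d, #|[pred i | m i == d]| = #|[pred j | m' j == d]|) ->
  rep_iso (Lsum m) (Lsum m').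
Proof.
move=> E.
(* Both index sets are partitioned by the value of m or m', below N. *)
have cardfib (A : finType) (f : A -> nat) N : (forall a, f a < N)%N ->
    #|A| = (\sum_(d < N) #|[pred a | f a == d]|)%N.
  move=> fN; rewrite -sum1_card (partition_big (fun a => Ordinal (fN a)) xpredT) //=.
  by apply: eq_bigr => d _; rewrite -sum1_card; apply: eq_bigl => a.
pose N := (maxn (\max_i m i) (\max_j m' j)).+1.
have eIJ : #|J| = #|I|.
  rewrite (cardfib J m' N) => [|j]; last first.
    by rewrite ltnS (leq_trans (leq_bigmax j)) // leq_maxr.
  rewrite (cardfib I m N) => [|i]; last first.
    by rewrite ltnS (leq_trans (leq_bigmax i)) // leq_maxl.
  by apply: eq_bigr => d _; rewrite E.
pose t' := [tuple m' (enum_val i) | i < #|J|].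
pose t := [tuple m (enum_val (cast_ord eIJ i)) | i < #|J|].
have tE d : count_mem d t = #|[pred i | m i == d]|.
  rewrite /t /= count_map -sum1_count -[RHS]sum1_card big_enum_cond /=.
  rewrite [RHS](reindex (fun i => enum_val (cast_ord eIJ i))) //=.
  exists (fun i => cast_ord (esym eIJ) (enum_rank i)) => i _.
    by rewrite enum_valK cast_ordK.
  by rewrite cast_ordKV enum_rankK.
have t'E d : count_mem d t' = #|[pred j | m' j == d]|.
  rewrite /t' /= count_map -sum1_count -[RHS]sum1_card big_enum_cond /=.
  by rewrite [RHS](reindex _ (onW_bij _ (enum_val_bij J))).
have /tuple_permP [p pE] : perm_eq t' t.
  by apply/allP => d _; rewrite /= tE t'E E.
pose h j := enum_val (cast_ord eIJ (p (enum_rank j))).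
have mh j : m' j = m (h j).
  have := congr1 (fun s => nth 0%N s (enum_rank j)) pE.
  rewrite -!tnth_nth !tnth_mktuple enum_rankK => ->.
  by rewrite /h.
have -> : m' = m \o h by apply: funext => j; rewrite mh.
apply: (@dsum_reindex _ _ I J h (fun i => L k (m i))).
exists (fun i => enum_val ((p^-1)%g (cast_ord (esym eIJ) (enum_rank i)))) => j.
  by rewrite /h enum_valK cast_ordK permK enum_rankK.
by rewrite /h enum_valK permKV cast_ordKV enum_rankK.
Qed.

Lemma decomposes_iso V W c : decomposes V c -> decomposes W c -> rep_iso V W.
Proof.
move=> [I [m [Vm cm]]] [J [m' [Wm cm']]].
apply: rep_iso_trans Vm _; apply: rep_iso_trans (rep_iso_sym Wm).
by apply: Lsum_iso => d; rewrite cm cm'.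
Qed.

Lemma decomposes_transfer V W c : rep_iso V W -> decomposes W c -> decomposes V c.
Proof.
by move=> VW [I [m [Wm cm]]]; exists I, m; split=> //; exact: rep_iso_trans Wm.
Qed.

Lemma decomposes_ext V c c' : c =1 c' -> decomposes V c -> decomposes V c'.
Proof. by move=> e [I [m [iso cm]]]; exists I, m; split=> // d; rewrite cm e. Qed.

Lemma decomposes_dsum (I : finType) (V : I -> rep k SL2) (c : I -> nat -> nat) :
  (forall i, decomposes (V i) (c i)) ->
  decomposes (dsum V) (fun d => \sum_i c i d)%N.
Proof.
move=> dec.
pose J i : finType := projT1 (cid (dec i)).
pose m i : J i -> nat := projT1 (cid (projT2 (cid (dec i)))).
have mP i : rep_iso (V i) (Lsum (m i)) /\
    forall d, #|[pred j | m i j == d]| = c i d.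
  exact: projT2 (cid (projT2 (cid (dec i)))).
exists {i : I & J i}, (fun p => m (tag p) (tagged p)); split=> [|d].
  apply: rep_iso_trans (dsum_flatten (fun i (j : J i) => L k (m i j))).
  by apply: dsum_iso => i; have [] := mP i.
rewrite -sum1_card (eq_bigr (fun i => \sum_(j : J i | m i j == d) 1)%N).
  by rewrite sig_big_dep.
by move=> i _; have [_ <-] := mP i; rewrite sum1_card.
Qed.

Lemma decomposes_L m : decomposes (L k m) (fun d => d == m : nat).
Proof.
exists 'I_1, (fun=> m); split=> [|d].
  apply: (@rep_isoI _ _ (L k m) (Lsum (fun=> m))
    (fun x => finfun (fun=> x) : dsum (fun=> L k m)) (fun x => x ord0)).
  - by move=> a x y; apply/ffunP => i; rewrite !ffunE.
  - by move=> x; rewrite ffunE.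
  - by move=> x; apply/ffunP => i; rewrite (ord1 i) !ffunE.
  - by move=> g x; apply/ffunP => i; rewrite !ffunE.
rewrite -sum1_card big_mkcond big_ord1 /= inE eq_sym.
by case: (_ == _).
Qed.

(** In V (x) W, with e_0 and e_1 the basis of the standard module V, f stands for
   e_0 (x) f 0 + e_1 (x) f 1. *)
Section StdTensor.
Variable W : rep k SL2.
Implicit Types f : {ffun 'I_2 -> W}.

Definition std_tensor_act (g : SL2) f : {ffun 'I_2 -> W} :=
  [ffun j => \sum_i g j i *: rep_act g (f i)].

Lemma std_tensor_act_linear g : linear (std_tensor_act g).
Proof.
move=> a x y; apply/ffunP => j; rewrite !ffunE scaler_sumr -big_split /=.
by apply: eq_bigr => i _; rewrite !ffunE rep_act_linear scalerDr !scalerA mulrC.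
Qed.

Lemma std_tensor_act1 f : std_tensor_act 1%g f = f.
Proof.
apply/ffunP => j; rewrite ffunE (bigD1 j) //= big1 => [|i ij].
  by rewrite mxE eqxx scale1r addr0 rep_act1.
by rewrite mxE eq_sym (negPf ij) scale0r.
Qed.

Lemma std_tensor_actM g h f :
  std_tensor_act (g * h)%g f = std_tensor_act g (std_tensor_act h f).
Proof.
apply/ffunP => j; rewrite !ffunE.
under [RHS]eq_bigr => i _.
  rewrite ffunE rep_act_sum scaler_sumr.
  under eq_bigr => l _ do rewrite rep_actZ -rep_actM scalerA.
  over.
rewrite exchange_big /=; apply: eq_bigr => i _.
by rewrite mxE scaler_suml.
Qed.

Definition std_tensor : rep k SL2 :=
  Rep std_tensor_act_linear std_tensor_act1 std_tensor_actM.
End StdTensor.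

Lemma std_tensor_iso V W : rep_iso V W -> rep_iso (std_tensor V) (std_tensor W).
Proof.
case/rep_isoE=> f [f' [lf fK f'K fact]].
pose F : {linear V -> W} := HB.pack f (GRing.isLinear.Build k V W *:%R f lf).
have FE : F =1 f by [].
apply: (@rep_isoI _ _ (std_tensor V) (std_tensor W)
  (fun x : {ffun 'I_2 -> V} => [ffun j => f (x j)] : {ffun 'I_2 -> W})
  (fun x : {ffun 'I_2 -> W} => [ffun j => f' (x j)] : {ffun 'I_2 -> V})).
- by move=> a x y; apply/ffunP => i; rewrite !ffunE lf.
- by move=> x; apply/ffunP => i; rewrite !ffunE fK.
- by move=> x; apply/ffunP => i; rewrite !ffunE f'K.
- move=> g x; apply/ffunP => j; rewrite !ffunE -FE linear_sum.
  by apply: eq_bigr => i _; rewrite linearZ /= fact ffunE.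
Qed.

Lemma std_tensor_dsum (I : finType) (V : I -> rep k SL2) :
  rep_iso (std_tensor (dsum V)) (dsum (fun i => std_tensor (V i))).
Proof.
apply: (@rep_isoI _ _ (std_tensor (dsum V)) (dsum (fun i => std_tensor (V i)))
  (fun x => finfun (fun i => [ffun j => x j i] : std_tensor (V i))
     : dsum (fun i => std_tensor (V i)))
  (fun x => [ffun j => (finfun (fun i => (x i : {ffun 'I_2 -> V i}) j) : dsum V)])).
- by move=> a x y; apply/ffunP => i; apply/ffunP => j; rewrite !ffunE.
- by move=> x; apply/ffunP => j; apply/ffunP => i; rewrite !ffunE.
- by move=> x; apply/ffunP => i; apply/ffunP => j; rewrite !ffunE.
- move=> g x; apply/ffunP => i; apply/ffunP => j; rewrite !ffunE.
  rewrite -[LHS]/((fun y : dsum V => y i) _).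
  elim/big_rec2: _ => [|l y z _ <-]; first by rewrite ffunE.
  by rewrite !ffunE.
Qed.

End Decomposition.

(** * Tensoring L(m) with the standard module *)

Section HomogeneousDerivatives.
Variables (k : comNzRingType) (n : nat).
Implicit Types (p : {mpoly k[n]}) (i : 'I_n).

Lemma mderiv_monomial_id (m : 'X_{1..n}) i :
  'X_i * ('X_[m] : {mpoly k[n]})^`M(i) = (m i)%:R *: 'X_[m].
Proof.
rewrite mderivX -scalerAr -mpolyXD.
have [->|mi] := eqVneq (m i) 0%N; first by rewrite !scale0r.
by rewrite addmC submK // lep1mP.
Qed.

Lemma mderiv_var i j : ('X_i : {mpoly k[n]})^`M(j) = (i == j)%:R.
Proof.
rewrite mderivX mnm1E; case: eqVneq => [->|_]; last by rewrite scale0r.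
by rewrite -{1}[U_(j)%MM]add0m addmK mpolyX0 scale1r.
Qed.

Lemma euler_homog d p :
  p \is d.-homog -> \sum_i 'X_i * p^`M(i) = d%:R *: p.
Proof.
move=> dp; rewrite {2}[p]mpolyE scaler_sumr.
under eq_bigr => i _ do rewrite [p in p^`M(i)]mpolyE raddf_sum mulr_sumr.
rewrite exchange_big /= big_seq [RHS]big_seq; apply: eq_bigr => m mp.
under eq_bigr => i _ do rewrite mderivZ -scalerAr mderiv_monomial_id.
rewrite -scaler_sumr -scaler_suml scalerA [RHS]scalerA mulrC -natr_sum.
by rewrite -mdegE (dhomog_mf dp mp).
Qed.

Lemma dhomog_mderiv d p i : p \is d.+1.-homog -> p^`M(i) \is d.-homog.
Proof.
move=> dp; rewrite [p]mpolyE raddf_sum big_seq /=; apply: rpred_sum => m mp.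
rewrite mderivZ; apply: rpredZ; rewrite mderivX.
have [->|mi] := eqVneq (m i) 0%N; first by rewrite scale0r rpred0.
apply: rpredZ; rewrite dhomogX /= -(eqn_add2r 1) -[X in (_ + X)%N](mdeg1 i).
by rewrite -mdegD submK ?lep1mP // addn1; apply/eqP/(dhomog_mf dp).
Qed.

Lemma mderiv_dhomog0 p i : p \is 0.-homog -> p^`M(i) = 0.
Proof.
move=> dp; rewrite [p]mpolyE raddf_sum big_seq big1 //= => m mp.
have /eqP := dhomog_mf dp mp; rewrite /= mdeg_eq0 => /eqP ->.
by rewrite mderivZ mderivX mnm0E scale0r scaler0.
Qed.

End HomogeneousDerivatives.

Section ClebschGordan.
Variable k : fieldType.
Local Notation SL2 := (SL2 k).
Local Notation x0 := ('X_0 : {mpoly k[2]}).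
Local Notation x1 := ('X_1 : {mpoly k[2]}).

Lemma big_I2 (V : nmodType) (F : 'I_2 -> V) : \sum_i F i = F 0 + F 1.
Proof.
by rewrite !big_ord_recl big_ord0 addr0; congr (_ + F _); apply: val_inj.
Qed.

Lemma forall_I2 (P : 'I_2 -> Prop) : P 0 -> P 1 -> forall i, P i.
Proof.
move=> P0 P1 [[|[|//]] i].
  by rewrite (_ : Ordinal i = 0) //; exact: val_inj.
by rewrite (_ : Ordinal i = 1) //; exact: val_inj.
Qed.

Lemma SL2_det2 (g : SL2) : g 0 0 * g 1 1 - g 0 1 * g 1 0 = 1.
Proof.
rewrite -(SL2_det g) (expand_det_row _ 0) big_I2 /cofactor !det_mx11 !mxE.
rewrite expr0 expr1 mul1r mulN1r mulrN.
by congr (_ * g _ _ - _ * g _ _); exact: val_inj.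
Qed.

Lemma subst_var (g : SL2) j :
  'X_j \mPo SL2_vars g = g 0 j *: x0 + g 1 j *: x1.
Proof. by rewrite comp_mpolyXU -tnth_nth tnth_mktuple big_I2. Qed.

(** Both sides are derivations along the substitution, so it is enough to compare
   them on the variables. *)
Lemma chain_rule (g : SL2) (a : 'I_2) (p : {mpoly k[2]}) :
  (p \mPo SL2_vars g)^`M(a) = \sum_b g a b *: (p^`M(b) \mPo SL2_vars g).
Proof.
pose ok (q : {mpoly k[2]}) :=
  (q \mPo SL2_vars g)^`M(a) = \sum_b g a b *: (q^`M(b) \mPo SL2_vars g).
have okM q r : ok q -> ok r -> ok (q * r).
  rewrite /ok !big_I2 => okq okr; rewrite rmorphM /= [LHS]mderivM okq okr.
  by rewrite !mderivM !rmorphD !rmorphM /= -!mul_mpolyC; ring.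
have ok1 : ok 1.
  rewrite /ok rmorph1 -mpolyC1 mderivC big1 // => b _.
  by rewrite mderivC rmorph0 scaler0.
have okX j : ok 'X_j.
  rewrite /ok subst_var big_I2 mderivD !mderivZ !mderiv_var !rmorph_nat.
  by move: a j @ok okM ok1 => a j _ _ _; elim/forall_I2: a; elim/forall_I2: j;
    rewrite !eqxx /= ?scaler0 ?addr0 ?add0r.
suff okm (m : 'X_{1..2}) : ok 'X_[m].
  rewrite -/(ok p) [p]mpolyE; elim/big_rec: _ => [|m q _ qok].
    by rewrite /ok rmorph0 mderiv0 big1 // => b _; rewrite mderiv0 rmorph0 scaler0.
  have := okm m; move: qok; rewrite /ok !big_I2 => eq em.
  rewrite comp_mpolyD comp_mpolyZ mderivD mderivZ em eq !mderivD !mderivZ.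
  rewrite !comp_mpolyD !comp_mpolyZ !scalerDr !scalerA.
  by rewrite ![p@_m * _]mulrC addrACA.
rewrite mpolyXE_id; elim/big_rec: _ => // i q _ qok; apply: (okM) => //.
by elim: (m i) => [|d IH]; rewrite ?expr0 ?exprS //; apply: okM.
Qed.

(** The projections of V (x) L(m), with e_0 (x) u + e_1 (x) v given by (u, v), to
   L(m + 1) and L(m - 1). *)
Definition cg_mul (u v : {mpoly k[2]}) := x0 * u + x1 * v.
Definition cg_contract (u v : {mpoly k[2]}) := u^`M(1) - v^`M(0).

(** The arguments on the left are the components of g (e_0 (x) u + e_1 (x) v). *)
Lemma cg_mul_act (g : SL2) u v :
  cg_mul (g 0 0 *: (u \mPo SL2_vars g) + g 0 1 *: (v \mPo SL2_vars g))
         (g 1 0 *: (u \mPo SL2_vars g) + g 1 1 *: (v \mPo SL2_vars g)) =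
  cg_mul u v \mPo SL2_vars g.
Proof.
by rewrite /cg_mul rmorphD !rmorphM /= !subst_var -!mul_mpolyC; ring.
Qed.

(** By the chain rule the contraction is multiplied by det g = 1. *)
Lemma cg_contract_act (g : SL2) u v :
  cg_contract (g 0 0 *: (u \mPo SL2_vars g) + g 0 1 *: (v \mPo SL2_vars g))
              (g 1 0 *: (u \mPo SL2_vars g) + g 1 1 *: (v \mPo SL2_vars g)) =
  cg_contract u v \mPo SL2_vars g.
Proof.
rewrite /cg_contract !mderivD !mderivZ !chain_rule !big_I2 rmorphB /=.
rewrite -[X in _ = X - _]scale1r -[X in _ = _ - X]scale1r -(SL2_det2 g).
rewrite -!mul_mpolyC; move: (_ \mPo _) (_ \mPo _) (_ \mPo _) (_ \mPo _) => a b c d.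
by rewrite !(mpolyCB, mpolyCM); ring.
Qed.

(** The components of the inverse of (cg_mul, cg_contract); by Euler's identity
   the constant c has to be the inverse of the degree of p. *)
Definition cg_inv0 (c : k) (p q : {mpoly k[2]}) := c *: (p^`M(0) + x1 * q).
Definition cg_inv1 (c : k) (p q : {mpoly k[2]}) := c *: (p^`M(1) - x0 * q).

Let euler2 d (u : {mpoly k[2]}) : u \is d.-homog ->
  x0 * u^`M(0) + x1 * u^`M(1) = d%:R * u.
Proof. by move=> /euler_homog; rewrite big_I2 scaler_nat mulr_natl. Qed.

Lemma cg_inv_mul d c p q : p \is d.-homog -> c * d%:R = 1 ->
  cg_mul (cg_inv0 c p q) (cg_inv1 c p q) = p.
Proof.
move=> /euler2 e cd; rewrite /cg_mul /cg_inv0 /cg_inv1 -!scalerAr -scalerDr.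
have -> : x0 * (p^`M(0) + x1 * q) + x1 * (p^`M(1) - x0 * q) = d%:R * p.
  by rewrite -e; ring.
by rewrite mulr_natl -scaler_nat scalerA cd scale1r.
Qed.

Lemma cg_inv_contract d c p q : q \is d.-homog -> c * d.+2%:R = 1 ->
  cg_contract (cg_inv0 c p q) (cg_inv1 c p q) = q.
Proof.
move=> /euler2 e cd; rewrite /cg_contract /cg_inv0 /cg_inv1 !mderivZ -scalerBr.
rewrite !(mderivD, mderivN, mderivM) !mderiv_var !eqxx mderiv_comm /=.
have -> : p^`M(1)^`M(0) + (1%:R * q + x1 * q^`M(1)) -
    (p^`M(1)^`M(0) - (1%:R * q + x0 * q^`M(0))) = d.+2%:R * q.
  rewrite (_ : d.+2%:R = d%:R + 1 + 1 :> {mpoly k[2]}); last by rewrite -!natr1.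
  by rewrite !mulrDl -e; ring.
by rewrite mulr_natl -scaler_nat scalerA cd scale1r.
Qed.

Lemma cg_mul_inv0 d c u v : u \is d.-homog -> c * d.+1%:R = 1 ->
  cg_inv0 c (cg_mul u v) (cg_contract u v) = u.
Proof.
move=> /euler2 e cd; rewrite /cg_contract /cg_inv0 /cg_mul.
rewrite !mderivD !mderivM !mderiv_var !eqxx /=.
have -> : 1%:R * u + x0 * u^`M(0) + ((1 == 0 :> 'I_2)%:R * v + x1 * v^`M(0)) +
    x1 * (u^`M(1) - v^`M(0)) = d.+1%:R * u.
  by rewrite -[d.+1%:R]natr1 mulrDl -e /=; ring.
by rewrite mulr_natl -scaler_nat scalerA cd scale1r.
Qed.

Lemma cg_mul_inv1 d c u v : v \is d.-homog -> c * d.+1%:R = 1 ->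
  cg_inv1 c (cg_mul u v) (cg_contract u v) = v.
Proof.
move=> /euler2 e cd; rewrite /cg_contract /cg_inv1 /cg_mul.
rewrite !mderivD !mderivM !mderiv_var !eqxx /=.
have -> : (0 == 1 :> 'I_2)%:R * u + x0 * u^`M(1) + (1%:R * v + x1 * v^`M(1)) -
    x0 * (u^`M(1) - v^`M(0)) = d.+1%:R * v.
  by rewrite -[d.+1%:R]natr1 mulrDl -e /=; ring.
by rewrite mulr_natl -scaler_nat scalerA cd scale1r.
Qed.

Lemma cg_mul_homog d u v : u \is d.-homog -> v \is d.-homog ->
  cg_mul u v \is d.+1.-homog.
Proof.
move=> du dv; have dX i : ('X_i : {mpoly k[2]}) \is 1.-homog.
  by rewrite dhomogX /= mdeg1.
by rewrite -[d.+1]add1n; apply: rpredD; exact: dhomogM.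
Qed.

Lemma cg_contract_homog d u v : u \is d.+1.-homog -> v \is d.+1.-homog ->
  cg_contract u v \is d.-homog.
Proof. by move=> du dv; apply: rpredB; exact: dhomog_mderiv. Qed.

Lemma cg_inv0_homog d c p q : p \is d.+2.-homog -> q \is d.-homog ->
  cg_inv0 c p q \is d.+1.-homog.
Proof.
move=> dp dq; apply/rpredZ/rpredD; first exact: dhomog_mderiv.
by rewrite -[d.+1]add1n; apply: dhomogM => //; rewrite dhomogX /= mdeg1.
Qed.

Lemma cg_inv1_homog d c p q : p \is d.+2.-homog -> q \is d.-homog ->
  cg_inv1 c p q \is d.+1.-homog.
Proof.
move=> dp dq; apply/rpredZ/rpredB; first exact: dhomog_mderiv.
by rewrite -[d.+1]add1n; apply: dhomogM => //; rewrite dhomogX /= mdeg1.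
Qed.

Hypothesis char0 : [pchar k] =i pred0.

(** The contraction vanishes on V (x) L(0), so this case stands apart. *)
Lemma std_tensor_L0 : rep_iso (std_tensor (L k 0)) (L k 1).
Proof.
pose f (x : {ffun 'I_2 -> dhomog 2 k 0}) : dhomog 2 k 1 :=
  DHomog (cg_mul_homog (valP (x 0)) (valP (x 1))).
pose f' (y : dhomog 2 k 1) : {ffun 'I_2 -> dhomog 2 k 0} :=
  [ffun j => DHomog (dhomog_mderiv j (valP y))].
apply: (@rep_isoI _ _ (std_tensor (L k 0)) (L k 1) f f').
- move=> a x y; apply: val_inj; rewrite /= !ffunE /= /cg_mul.
  by rewrite scalerDr !scalerAr !mulrDr addrACA.
- move=> x; apply/ffunP => j; rewrite ffunE; apply: val_inj => /=.
  rewrite /cg_mul mderivD !mderivM !mderiv_var !mderiv_dhomog0 ?(valP (x _)) //.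
  by elim/forall_I2: j; rewrite !mulr0 ?mul1r ?mul0r ?addr0 ?add0r.
- move=> y; apply: val_inj; rewrite /= /cg_mul !ffunE /=.
  by rewrite (euler2 (valP y)) mul1r.
- move=> g x; apply: val_inj; rewrite /= !ffunE !big_I2 /=.
  exact: cg_mul_act.
Qed.

Lemma std_tensor_LS m : rep_iso (std_tensor (L k m.+1))
  (dsum (fun b : bool => L k (if b then m.+2 else m))).
Proof.
pose T (b : bool) : rep k SL2 := L k (if b then m.+2 else m).
pose c : k := m.+2%:R^-1.
have cm : c * m.+2%:R = 1 by rewrite mulVf // natr_neq0.
pose f (x : {ffun 'I_2 -> dhomog 2 k m.+1}) : dsum T := finfun (fun b =>
  if b as b return T b
  then DHomog (cg_mul_homog (valP (x 0)) (valP (x 1)))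
  else DHomog (cg_contract_homog (valP (x 0)) (valP (x 1)))).
pose f' (y : dsum T) : {ffun 'I_2 -> dhomog 2 k m.+1} :=
  let p : dhomog 2 k m.+2 := y true in let q : dhomog 2 k m := y false in
  [ffun j => if j == 0 then DHomog (cg_inv0_homog c (valP p) (valP q))
             else DHomog (cg_inv1_homog c (valP p) (valP q))].
apply: (@rep_isoI _ _ (std_tensor (L k m.+1)) (dsum T) f f').
- move=> a x y; apply/ffunP => -[]; rewrite !ffunE; apply: val_inj => /=.
    by rewrite /cg_mul scalerDr !scalerAr !mulrDr addrACA.
  rewrite /cg_contract !mderivD !mderivZ scalerBr.
  by rewrite opprD addrACA.
- move=> x; apply/ffunP => j; rewrite ffunE.
  elim/forall_I2: j => /=; apply: val_inj; rewrite /= !ffunE /=.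
    exact: cg_mul_inv0 (valP (x 0)) cm.
  exact: cg_mul_inv1 (valP (x 1)) cm.
- move=> y; apply/ffunP => -[]; rewrite !ffunE; apply: val_inj => /=.
    exact: cg_inv_mul (valP (y true : dhomog 2 k m.+2)) cm.
  exact: cg_inv_contract (valP (y false : dhomog 2 k m)) cm.
- move=> g x; apply/ffunP => -[]; rewrite !ffunE; apply: val_inj;
    rewrite /= !big_I2 /=; [exact: cg_mul_act | exact: cg_contract_act].
Qed.

(** Tensoring with V turns the multiplicities c of the modules L(d) into these:
   L(d) comes from L(d - 1) and from L(d + 1). *)
Definition cg_mult (c : nat -> nat) (d : nat) : nat :=
  ((if d is d'.+1 then c d' else 0) + c d.+1)%N.

Lemma decomposes_std_tensor (W : rep k SL2) (c : nat -> nat) :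
  decomposes W c -> decomposes (std_tensor W) (cg_mult c).
Proof.
case=> I [m [iso cE]].
have decL l : decomposes (std_tensor (L k l)) (cg_mult (fun d => (d == l) : nat)).
  case: l => [|l].
    apply: decomposes_transfer std_tensor_L0 _.
    by apply: decomposes_ext (decomposes_L k 1) => -[|[|d]].
  apply: decomposes_transfer (std_tensor_LS l) _.
  apply: decomposes_ext (decomposes_dsum (fun b : bool => decomposes_L k _)) => d.
  by rewrite /cg_mult big_bool /=; case: d => [|d]; rewrite ?eqSS.
apply: decomposes_transfer (std_tensor_iso iso) _.
apply: decomposes_transfer (std_tensor_dsum _) _.
apply: decomposes_ext (decomposes_dsum (fun i => decL (m i))) => d.
rewrite /cg_mult big_split /=; congr (_ + _)%N.
  case: d => [|d]; first by rewrite big1.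
  rewrite -cE -sum1_card [RHS]big_mkcond; apply: eq_bigr => i _.
  by rewrite inE eq_sym; case: eqP.
rewrite -cE -sum1_card [RHS]big_mkcond; apply: eq_bigr => i _.
by rewrite inE eq_sym; case: eqP.
Qed.

End ClebschGordan.

(** * Counting unary-binary tree shapes *)

Inductive shape := Leaf | Unary of shape | Binary of shape & shape.

HB.instance Definition _ := gen_eqMixin shape.
HB.instance Definition _ := gen_choiceMixin shape.

Fixpoint nodes (s : shape) : nat :=
  match s with
  | Leaf => 1
  | Unary s => (nodes s).+1
  | Binary s t => (nodes s + nodes t).+1
  end.

Fixpoint unaries (s : shape) : nat :=
  match s with
  | Leaf => 0
  | Unary s => (unaries s).+1
  | Binary s t => unaries s + unaries t
  end.

(** Counting forests instead of single trees gives a linear recursion: removing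
   the root of the first of h trees leaves h - 1, h or h + 1 trees. *)
Fixpoint forests (n h : nat) : seq (seq shape) :=
  match n, h with
  | 0, 0 => [:: [::]]
  | n.+1, h.+1 =>
      [seq Leaf :: f | f <- forests n h] ++
      [seq Unary (head Leaf f) :: behead f | f <- forests n h.+1] ++
      [seq Binary (head Leaf f) (nth Leaf f 1) :: drop 2 f | f <- forests n h.+2]
  | _, _ => [::]
  end.

Lemma nodes_gt0 s : (0 < nodes s)%N.
Proof. by case: s. Qed.

Lemma mem_forests n h f :
  (f \in forests n h) = (size f == h) && (sumn (map nodes f) == n).
Proof.
elim: n h f => [|n IH] [|h] f /=.
- by rewrite inE; case: f.
- by case: f => [|s f] //=; rewrite andbC addn_eq0 -leqn0 leqNgt nodes_gt0.
- by case: f.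
rewrite !mem_cat.
case: f => [|s f] /=.
  by apply/negP => /or3P [] /mapP [].
case: s => [|s|s t]; apply/or3P/idP.
- case=> /mapP [f'] //; rewrite IH => f'P [->]; exact: f'P.
- by rewrite eqSS /= add1n eqSS -IH => fP; apply: Or31; apply/mapP; exists f.
- case=> /mapP [f'] //; rewrite IH => /andP [fh fn] [-> ->].
  by case: f' fh fn => //= s' f'; rewrite addSn !eqSS => -> ->.
- rewrite eqSS /= addSn eqSS => /andP [fh fn]; apply: Or32; apply/mapP.
  by exists (s :: f); rewrite // IH /= eqSS fh fn.
- case=> /mapP [f'] //; rewrite IH => /andP [fh fn] [-> -> ->].
  case: f' fh fn => [|s' [|t' f']] //=; rewrite addSn !eqSS drop0 => ->.
  by rewrite addnA.
- rewrite eqSS /= addSn eqSS -addnA => /andP [fh fn]; apply: Or33; apply/mapP.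
  by exists [:: s, t & f]; rewrite ?IH /= ?drop0 // !eqSS fh fn.
Qed.

Lemma uniq_forests n h : uniq (forests n h).
Proof.
elim: n h => [|n IH] [|h] //=.
rewrite !cat_uniq; apply/and3P; split; last apply/and3P; try split.
- by rewrite map_inj_uniq // => f f' [].
- apply/hasPn => f; rewrite mem_cat => /orP [] /mapP [f' _ ->];
    by apply/mapP => -[].
- rewrite map_inj_in_uniq // => f f'; rewrite !mem_forests.
  by case: f => // s f _; case: f' => //= s' f' _ [-> ->].
- by apply/hasPn => f /mapP [f' _ ->]; apply/mapP => -[].
- rewrite map_inj_in_uniq // => f f'; rewrite !mem_forests.
  case: f => [|s [|t f]] //= _; case: f' => [|s' [|t' f']] //= _.
  by rewrite !drop0 => -[-> -> ->].
Qed.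

Definition shapes n : seq shape := [seq head Leaf f | f <- forests n 1].

Lemma mem_shapes n s : (s \in shapes n) = (nodes s == n).
Proof.
apply/mapP/eqP => [[f]|sn]; last by exists [:: s]; rewrite // mem_forests /= addn0 sn !eqxx.
by rewrite mem_forests => /andP []; case: f => [|s' [|]] //= _ /eqP; rewrite addn0 => <- ->.
Qed.

Lemma uniq_shapes n : uniq (shapes n).
Proof.
rewrite map_inj_in_uniq ?uniq_forests // => f f'; rewrite !mem_forests.
by case: f => [|s [|]] //= _; case: f' => [|s' [|]] //= _ ->.
Qed.

Definition forest_sum (F : nat -> nat) n h : nat :=
  \sum_(f <- forests n h) F (sumn (map unaries f)).

Lemma forest_sumS F n h : forest_sum F n.+1 h.+1 =
  (forest_sum F n h + forest_sum (F \o succn) n h.+1 + forest_sum F n h.+2)%N.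
Proof.
rewrite /forest_sum /= !big_cat !big_map /= -addnA; congr (_ + (_ + _))%N.
  apply: eq_big_seq => f; rewrite mem_forests.
  by case: f => //= s f _; rewrite addSn.
apply: eq_big_seq => f; rewrite mem_forests.
by case: f => [|s [|t f]] //= _; rewrite drop0 addnA.
Qed.

Lemma forest_sum_shapes F n : forest_sum F n 1 = \sum_(s <- shapes n) F (unaries s).
Proof.
rewrite big_map; apply: eq_big_seq => f; rewrite mem_forests.
by case: f => [|s [|]] //= _; rewrite addn0.
Qed.

(** An integral lower index removes the boundary cases from the recursions. *)
Definition binz (n : nat) (j : int) : int :=
  if j is Posz i then 'C(n, i)%:Z else 0.

Lemma binzS n j : binz n.+1 j = binz n j + binz n (j - 1).
Proof.
case: j => [[|j]|j] //; first by rewrite /= !bin0 addr0.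
by rewrite (_ : j.+1%:Z - 1 = j); [rewrite /= binS PoszD | lia].
Qed.

Lemma binz_sym n j : binz n j = binz n (n%:Z - j).
Proof.
case: j => [j|j]; last first.
  by rewrite (_ : n%:Z - Negz j = (n + j.+1)%N) /= ?bin_small //; lia.
have [jn|nj] := leqP j n; first by rewrite subzn //= bin_sub.
by rewrite /= bin_small // (_ : n%:Z - j%:Z = Negz (j - n).-1) //; lia.
Qed.

Lemma binz_neg n j : j < 0 -> binz n j = 0.
Proof. by case: j. Qed.

Lemma binz0 j : binz 0 j = (j == 0)%:R.
Proof. by case: j => [[|j]|j]. Qed.

(** The multiplicity of L(d) in the u-th tensor power of the standard module. *)
Definition tensor_mult (u : nat) : nat -> nat := iter u cg_mult (fun d => d == 0 : nat).

(** By the cycle lemma, the labelled forests of h + 1 trees with n + 1 nodes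
   and k labels 1 number (h + 1) / (n + 1) * C(n + 1, k) * C(n + 1, h + 1 + k);
   a binary node counts as carrying one label 1, since it stands for the
   determinant of V. This is the same number without the division. *)
Definition forest_weight (n : nat) (h k : int) : int :=
  binz n k * binz n (h + k) - binz n (k - 1) * binz n (h + k + 1).

(** The four terms are the cases of the first root: a leaf, a unary node labelled
   0 or 1, or a binary node. *)
Lemma forest_weightS n h k : forest_weight n.+1 h k =
  forest_weight n (h - 1) k + forest_weight n h k + forest_weight n h (k - 1) +
  forest_weight n (h + 1) (k - 1).
Proof.
rewrite /forest_weight !binzS.
have e1 : h - 1 + k = h + k - 1 by ring.
have e2 : h + (k - 1) = h + k - 1 by ring.
have e3 : h + 1 + (k - 1) = h + k by ring.
have e4 : h + k + 1 - 1 = h + k by ring.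
have e5 : h + k - 1 + 1 = h + k by ring.
rewrite e1 e2 e3 e4 e5; ring.
Qed.

Lemma forest_mult_cg n h d :
  forest_sum ((tensor_mult^~ d) \o succn) n h =
  ((if d is d'.+1 then forest_sum (tensor_mult^~ d') n h else 0) +
   forest_sum (tensor_mult^~ d.+1) n h)%N.
Proof.
rewrite /forest_sum; case: d => [|d]; first by rewrite add0n.
by rewrite -big_split.
Qed.

Lemma forest_sum0 F n : forest_sum F n.+1 0 = 0%N.
Proof. by rewrite /forest_sum big_nil. Qed.

(** Each L(d) contributes one to the weights d, d - 2, down to - d, so its
   multiplicity is the dimension of the weight space of weight d minus that of
   weight d + 2, and k labels 1 give the weight n - h - 2 k. The index k may be
   negative, when both sides vanish. *)
Lemma forest_multE n h d (k : int) : n%:Z = h%:Z + k + k + d%:Z ->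
  (forest_sum (tensor_mult^~ d) n.+1 h.+1)%:Z =
  forest_weight n h k - forest_weight n h (k - 1).
Proof.
elim: n h d k => [|n IH] h d k e.
  rewrite forest_sumS /forest_sum.
  have -> : forests 0 h.+1 = [::] by [].
  have -> : forests 0 h.+2 = [::] by [].
  rewrite !big_nil !addn0 /forest_weight !binz0.
  case: h e => [|h] e /=; rewrite ?big_nil ?big_seq1.
    rewrite /tensor_mult /=; case: d e => [|d] e.
      by have -> : k = 0 by lia.
    have /negPf -> : k != 0 by lia.
    have /negPf -> : k - 1 != 0 by lia.
    have /negPf -> : k - 1 - 1 != 0 by lia.
    by rewrite !mul0r !subr0.
  have /negPf -> : k != 0 by lia.
  have /negPf -> : k - 1 != 0 by lia.
  have /negPf -> : k - 1 - 1 != 0 by lia.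
  by rewrite !mul0r !subr0.
rewrite forest_sumS forest_mult_cg !PoszD !forest_weightS.
have -> : (forest_sum (tensor_mult^~ d) n.+1 h)%:Z =
    forest_weight n (h%:Z - 1) k - forest_weight n (h%:Z - 1) (k - 1).
  case: h e => [|h] e; last first.
    by rewrite (_ : h.+1%:Z - 1 = h); [apply: IH | ]; lia.
  rewrite forest_sum0 /forest_weight.
  rewrite (_ : 0%:Z - 1 + k = k - 1); last by ring.
  rewrite (_ : 0%:Z - 1 + (k - 1) = k - 1 - 1); last by ring.
  by rewrite !subrK [binz n (k - 1) * _]mulrC subrr [binz n (k - 1 - 1) * _]mulrC subrr.
have -> : (if d is d'.+1 then forest_sum (tensor_mult^~ d') n.+1 h.+1 else 0%N)%:Z =
    forest_weight n h k - forest_weight n h (k - 1).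
  case: d e => [|d] e; last by rewrite (IH h d k) //; lia.
  (* The weights 1 and - 1 have the same multiplicity. *)
  rewrite /forest_weight [binz n k]binz_sym [binz n (h%:Z + k)]binz_sym.
  rewrite [binz n (k - 1 - 1)]binz_sym [binz n (h%:Z + (k - 1) + 1)]binz_sym.
  rewrite (_ : n%:Z - k = h%:Z + (k - 1)); last by lia.
  rewrite (_ : n%:Z - (h%:Z + k) = k - 1); last by lia.
  rewrite (_ : n%:Z - (k - 1 - 1) = h%:Z + k + 1); last by lia.
  rewrite (_ : n%:Z - (h%:Z + (k - 1) + 1) = k - 1); last by lia.
  ring.
rewrite (IH h d.+1 (k - 1)); last by lia.
rewrite (IH h.+1 d (k - 1)); last by lia.
rewrite (_ : h.+1%:Z = h%:Z + 1); last by lia.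
ring.
Qed.

(** The number of unary nodes has the parity of n - h, and the u-th tensor power
   contains L(d) only if d has the parity of u. *)
Lemma forest_mult_parity n h d : odd (n + h + d) ->
  forest_sum (tensor_mult^~ d) n.+1 h.+1 = 0%N.
Proof.
elim: n h d => [|n IH] h d o; rewrite forest_sumS.
  rewrite /forest_sum; have -> : forests 0 h.+1 = [::] by [].
  have -> : forests 0 h.+2 = [::] by [].
  rewrite !big_nil !addn0.
  by case: h o => [|h] o /=; rewrite ?big_nil ?big_seq1 //; case: d o.
rewrite forest_mult_cg IH; last by move: o; lia.
rewrite IH ?addn0; last by move: o; lia.
case: h o => [|h] o.
  by rewrite forest_sum0; case: d o => // d o; rewrite IH //; move: o; lia.
rewrite IH; last by move: o; lia.
by case: d o => // d o; rewrite IH //; move: o; lia.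
Qed.

(** The ballot numbers; summing [forest_weight] over k would give them too, by
   Vandermonde's identity. *)
Lemma forest_count n h :
  (forest_sum (fun u => 2 ^ u)%N n.+1 h.+1)%:Z =
  binz n.*2.+1 (n%:Z - h%:Z) - binz n.*2.+1 (n%:Z - h%:Z - 1).
Proof.
elim: n h => [|n IH] h; rewrite forest_sumS.
  rewrite /forest_sum; have -> : forests 0 h.+1 = [::] by [].
  have -> : forests 0 h.+2 = [::] by [].
  by rewrite !big_nil !addn0; case: h => [|h] /=; rewrite ?big_nil ?big_seq1.
have -> : forest_sum ((fun u => 2 ^ u)%N \o succn) n.+1 h.+1 =
    (forest_sum (fun u => 2 ^ u)%N n.+1 h.+1).*2.
  by rewrite /forest_sum -mul2n big_distrr; apply: eq_bigr => f _; rewrite /= expnS.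
rewrite -addnn !PoszD !IH.
have -> : (forest_sum (fun u => 2 ^ u)%N n.+1 h)%:Z =
    binz n.*2.+1 (n%:Z - h%:Z + 1) - binz n.*2.+1 (n%:Z - h%:Z).
  case: h => [|h]; last first.
    rewrite IH; congr (binz _ _ - binz _ _); lia.
  have e : n.*2.+1%:Z - (n%:Z - 0%:Z) = n%:Z - 0%:Z + 1 by lia.
  by rewrite forest_sum0 [X in _ = _ - X]binz_sym e subrr.
rewrite doubleS !(binzS n.*2.+2) !(binzS n.*2.+1).
rewrite (_ : n.+1%:Z - h%:Z = n%:Z - h%:Z + 1); last by lia.
rewrite (_ : n%:Z - h.+1%:Z = n%:Z - h%:Z - 1); last by lia.
rewrite !addrK; ring.
Qed.

Lemma shapes_count n : (\sum_(s <- shapes n.+1) 2 ^ unaries s = catalan n.+1)%N.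
Proof.
rewrite -forest_sum_shapes; apply/eqP; rewrite -eqz_nat forest_count; apply/eqP.
(* Both sides agree after multiplication by n + 2. *)
have e1 := catalanE n.+1.
have e2 : 'C(n.+1.*2, n.+1) = (2 * 'C(n.*2.+1, n))%N.
  have e : 'C(n.*2.+1, n.+1) = 'C(n.*2.+1, n).
    by rewrite -(@bin_sub _ n); [congr 'C(_, _) | ]; lia.
  by rewrite doubleS binS e addnn -mul2n.
have e3 : (n.+2%:Z * binz n.*2.+1 (n%:Z - 0%:Z - 1) = n%:Z * 'C(n.*2.+1, n)%:Z).
  case: (n) => [|m]; first by rewrite mulr0 mul0r.
  rewrite (_ : m.+1%:Z - 0%:Z - 1 = m) /=; last by lia.
  have := mul_bin_left m.+1.*2.+1 m.
  rewrite (_ : m.+1.*2.+1 - m = m.+3)%N; last by lia.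
  by rewrite -!PoszM => ->.
apply: (@mulfI _ (n.+2%:Z)) => //.
rewrite mulrBr e3 subr0 /= -[RHS]PoszM e1 e2.
rewrite PoszM -mulrBl; congr (_ * _); lia.
Qed.

Lemma forest_weight_narayana (n i : nat) :
  forest_weight n 0 i = (narayana n.+1 i)%:Z.
Proof.
rewrite /forest_weight !add0r.
set a := 'C(n.+1, i); set b := 'C(n.+1, i.+1).
have e := @narayanaE n.+1 i isT; rewrite -/a -/b in e.
have [ni|ini] := ltnP n.+1 i.
  rewrite /narayana bin_small // mul0n div0n.
  rewrite binz_sym [binz n (i%:Z + 1)]binz_sym binz_neg; last by lia.
  by rewrite [binz n (_ - (i%:Z + 1))]binz_neg ?mulr0 ?mul0r //; lia.
have ea : (n.+1%:Z * binz n i = (n.+1%:Z - i%:Z) * a%:Z).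
  rewrite /= /a subzn // -!PoszM; congr Posz.
  by rewrite mul_bin_down.
have eb : (n.+1%:Z * binz n i = i.+1%:Z * b%:Z).
  by rewrite /= /b -!PoszM; congr Posz; rewrite mul_bin_diag.
have ec : (n.+1%:Z * binz n (i%:Z - 1) = i%:Z * a%:Z).
  case: (i) @a ea e {eb} => [|j] a _ _; first by rewrite mulr0 mul0r.
  rewrite (_ : j.+1%:Z - 1 = j) /=; last by lia.
  by rewrite /a -!PoszM; congr Posz; rewrite mul_bin_diag.
have ed : (n.+1%:Z * binz n (i%:Z + 1) = (n%:Z - i%:Z) * b%:Z).
  rewrite (_ : i%:Z + 1 = i.+1) /=; last by lia.
  have [in'|] := leqP i n; last first.
    by move=> ni; rewrite /b !bin_small ?mulr0 //; lia.
  rewrite /b subzn // -!PoszM; congr Posz.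
  by have := mul_bin_down n.+1 i.+1; rewrite subSS.
apply: (@mulfI _ (n.+1%:Z * n.+1%:Z)) => //.
have -> : n.+1%:Z * n.+1%:Z *
    (binz n i * binz n i - binz n (i%:Z - 1) * binz n (i%:Z + 1))
  = (n.+1%:Z * binz n i) * (n.+1%:Z * binz n i) -
    (n.+1%:Z * binz n (i%:Z - 1)) * (n.+1%:Z * binz n (i%:Z + 1)) by ring.
have e' : n.+1%:Z * (narayana n.+1 i)%:Z = a%:Z * b%:Z by rewrite -!PoszM e.
rewrite {1}ea eb ec ed -[RHS]mulrA e'.
rewrite (_ : n.+1%:Z = n%:Z + 1); last by lia.
rewrite (_ : i.+1%:Z = i%:Z + 1); last by lia.
ring.
Qed.

Lemma shapes_mult n d : (\sum_(s <- shapes n.+1) tensor_mult (unaries s) d =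
  \sum_(i < n./2.+1) L_mult n.+1 i * (d == n - i.*2))%N.
Proof.
rewrite -(forest_sum_shapes (tensor_mult^~ d)).
(* L(d) occurs only if d = n - 2 i for some i, and then in one summand. *)
have [o|e] := boolP (odd (n + d)).
  rewrite forest_mult_parity ?addn0 // big1 // => i _.
  have := ltn_ord i; case: eqVneq => [dn|_]; last by rewrite muln0.
  by move: o; rewrite dn; have := leq_half_double n n; lia.
have [dn|nd] := leqP d n; last first.
  have [k kE] : exists k : nat, (d = n + k.*2)%N.
    by exists ((d - n)./2); move: e nd; lia.
  rewrite big1 => [|i _]; last by rewrite (_ : _ == _ = false) ?muln0 //; lia.
  apply/eqP; rewrite -eqz_nat (@forest_multE n 0 d (- k%:Z)); last by lia.
  by rewrite /forest_weight !(binz_neg n (_ : - k%:Z < 0), binz_neg n (_ : - k%:Z - 1 < 0),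
  binz_neg n (_ : - k%:Z - 1 - 1 < 0)) ?mul0r ?subrr //; lia.
pose i := ((n - d)./2)%N.
have ei : (n = i.*2 + d)%N by rewrite /i; move: e dn; lia.
have ilt : (i < n./2.+1)%N by lia.
rewrite (bigD1 (Ordinal ilt)) //= big1 => [|j ji]; last first.
  rewrite (_ : _ == _ = false) ?muln0 //; apply/eqP => dE.
  have ilj := ltn_ord j; case/eqP: ji; apply: val_inj => /=; lia.
rewrite (_ : _ == _ = true) ?muln1 ?addn0; last by apply/eqP; lia.
apply: (@addIn (if i is j.+1 then narayana n.+1 j else 0)).
have key : (forest_sum (tensor_mult^~ d) n.+1 1 +
    (if i is j.+1 then narayana n.+1 j else 0) = narayana n.+1 i)%N.
  apply/eqP; rewrite -eqz_nat PoszD (@forest_multE n 0 d i) ?ei; last by lia.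
  rewrite -ei forest_weight_narayana; case: (i) => [|j].
    have -> : forest_weight n 0 (0%:Z - 1) = 0 by rewrite /forest_weight !mul0r.
    by rewrite subr0 addr0.
  rewrite (_ : j.+1%:Z - 1 = j) ?forest_weight_narayana ?subrK //; lia.
by rewrite key /L_mult subnK // -key leq_addl.
Qed.

(** * Tensor powers of the standard module in coordinates *)

Section TupleSums.
Variables (T : finType) (V : nmodType).

Lemma big_tuple0 (F : seq T -> V) : \sum_(w : 0.-tuple T) F w = F [::].
Proof.
rewrite (bigD1 [tuple]) //= big1 ?addr0 // => w /eqP; case.
by rewrite tuple0.
Qed.

Lemma big_tupleS n (F : seq T -> V) :
  \sum_(w : n.+1.-tuple T) F w = \sum_i \sum_(w : n.-tuple T) F (i :: w).
Proof.
rewrite pair_big /= (reindex (fun p : T * n.-tuple T => [tuple of p.1 :: p.2])) //=.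
exists (fun w : n.+1.-tuple T => (thead w, [tuple of behead w])) => [[i w]|w] _ /=.
  by rewrite theadE; congr pair; apply: val_inj.
by rewrite -tuple_eta.
Qed.

Lemma big_tuple_cat m n (F : seq T -> V) :
  \sum_(w : (m + n).-tuple T) F w =
  \sum_(u : m.-tuple T) \sum_(v : n.-tuple T) F (u ++ v).
Proof.
elim: m F => [|m IH] F.
  by rewrite (big_tuple0 (fun u => \sum_(v : n.-tuple T) F (u ++ v))).
rewrite (big_tupleS _ (fun u => \sum_(v : n.-tuple T) F (u ++ v))).
rewrite -[LHS]/(\sum_(w : (m + n).+1.-tuple T) F w) big_tupleS.
by apply: eq_bigr => i _; exact: (IH (fun w => F (i :: w))).
Qed.
End TupleSums.

Section TensorPowers.
Variable k : fieldType.
Local Notation SL2 := (SL2 k).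

Definition trivial_rep : rep k SL2 :=
  @Rep k SL2 k^o (fun _ x => x) (fun _ _ _ _ => erefl) (fun _ => erefl)
    (fun _ _ _ => erefl).

Lemma trivial_rep_L0 : rep_iso trivial_rep (L k 0).
Proof.
have homC (c : k) : (c%:MP : {mpoly k[2]}) \is 0.-homog.
  by rewrite -[c%:MP]mulr1 mul_mpolyC; apply/rpredZ/dhomog1.
apply: (@rep_isoI _ _ trivial_rep (L k 0)
  (fun c => DHomog (homC c)) (fun p => (p : dhomog 2 k 0)@_0)).
- by move=> a x y; apply: val_inj; rewrite /= mpolyCD mpolyCM mul_mpolyC.
- by move=> c; rewrite /= mcoeffC eqxx mulr1.
- move=> p; apply: val_inj => /=; apply/mpolyP => m; rewrite mcoeffC.
  have [->|m0] := eqVneq m 0%MM; first by rewrite mulr1.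
  by rewrite mulr0 (dhomog_nemf_coeff (valP p)) // mdeg_eq0.
- by move=> g c; apply: val_inj; rewrite /= comp_mpolyC.
Qed.

Fixpoint tensor_pow (u : nat) : rep k SL2 :=
  if u is u.+1 then std_tensor (tensor_pow u) else trivial_rep.

Lemma decomposes_tensor_pow u : [pchar k] =i pred0 ->
  decomposes (tensor_pow u) (tensor_mult u).
Proof.
move=> char0; elim: u => [|u IH]; last exact: decomposes_std_tensor.
exact: decomposes_transfer trivial_rep_L0 (decomposes_L k 0).
Qed.

(** Basis elements are indexed by untyped words, so that the label words of
   subtrees can be cut out of the label word of a tree. *)
Fixpoint tensor_coord (u : nat) : tensor_pow u -> seq 'I_2 -> k :=
  match u with
  | 0 => fun x _ => x
  | u.+1 => fun x w =>
      tensor_coord ((x : {ffun 'I_2 -> tensor_pow u}) (head 0 w)) (behead w)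
  end.

Fixpoint tensor_of_coord (u : nat) (F : seq 'I_2 -> k) : tensor_pow u :=
  match u with
  | 0 => F [::]
  | u.+1 => [ffun i => tensor_of_coord u (fun w => F (i :: w))]
  end.

Lemma tensor_coordD u a (x y : tensor_pow u) w :
  tensor_coord (a *: x + y) w = a * tensor_coord x w + tensor_coord y w.
Proof. by elim: u x y w => [|u IH] x y w //=; rewrite !ffunE IH. Qed.

Lemma tensor_coord0 u w : tensor_coord (0 : tensor_pow u) w = 0.
Proof.
by have := tensor_coordD (-1) (0 : tensor_pow u) 0 w; rewrite scaleN1r mulN1r !addNr.
Qed.

Lemma tensor_coord_sum u (I : finType) (c : I -> k) (x : I -> tensor_pow u) w :
  tensor_coord (\sum_i c i *: x i) w = \sum_i c i * tensor_coord (x i) w.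
Proof.
elim/big_rec2: _ => [|i y z _ <-]; first exact: tensor_coord0.
exact: tensor_coordD.
Qed.

Lemma tensor_of_coordK u F w :
  size w = u -> tensor_coord (tensor_of_coord u F) w = F w.
Proof.
elim: u F w => [|u IH] F [|i w] //= [sw].
by rewrite ffunE IH.
Qed.

Lemma tensor_coord_inj u (x y : tensor_pow u) :
  (forall w : u.-tuple 'I_2, tensor_coord x w = tensor_coord y w) -> x = y.
Proof.
elim: u x y => [|u IH] x y xy; first exact: (xy [tuple]).
apply/ffunP => i; apply: IH => w; exact: (xy [tuple of i :: w]).
Qed.

(** The matrix coefficients of g on tensor powers, g acting on each factor. *)
Definition word_coef (g : SL2) (v w : seq 'I_2) : k :=
  \prod_(p <- zip v w) g p.1 p.2.

Lemma word_coef_nil g : word_coef g [::] [::] = 1.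
Proof. exact: big_nil. Qed.

Lemma word_coef_cons g i j v w :
  word_coef g (i :: v) (j :: w) = g i j * word_coef g v w.
Proof. exact: big_cons. Qed.

Lemma word_coef_cat g v w v' w' : size v = size w ->
  word_coef g (v ++ v') (w ++ w') = word_coef g v w * word_coef g v' w'.
Proof. by move=> vw; rewrite /word_coef zip_cat // big_cat. Qed.

Lemma tensor_coord_act u g (x : tensor_pow u) (v : u.-tuple 'I_2) :
  tensor_coord (rep_act g x) v =
  \sum_(w : u.-tuple 'I_2) word_coef g v w * tensor_coord x w.
Proof.
elim: u x v => [|u IH] x v.
  rewrite (big_tuple0 (fun w => word_coef g v w * tensor_coord x w)) tuple0.
  by rewrite word_coef_nil mul1r.
rewrite (big_tupleS _ (fun w => word_coef g v w * tensor_coord x w)).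
case/tupleP: v => j v; rewrite /= ffunE tensor_coord_sum.
apply: eq_bigr => i _; rewrite IH mulr_sumr; apply: eq_bigr => w _.
by rewrite word_coef_cons mulrA.
Qed.

End TensorPowers.

(** * Algebras with two compatible products *)

Section LinearFunctions.
Variables (k : fieldType) (V W : lmodType k) (f : V -> W).
Hypothesis lf : linear f.

Lemma lin_fun0 : f 0 = 0.
Proof. by have := lf (-1) 0 0; rewrite !scaleN1r !addNr. Qed.
Lemma lin_funD x y : f (x + y) = f x + f y.
Proof. by have := lf 1 x y; rewrite !scale1r. Qed.
Lemma lin_funZ a x : f (a *: x) = a *: f x.
Proof. by have := lf a x 0; rewrite !addr0 lin_fun0 addr0. Qed.
Lemma lin_funB x y : f (x - y) = f x - f y.
Proof. by rewrite -scaleN1r lin_funD lin_funZ scaleN1r. Qed.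
Lemma lin_fun_sum (I : Type) (r : seq I) (P : pred I) (F : I -> V) :
  f (\sum_(i <- r | P i) F i) = \sum_(i <- r | P i) f (F i).
Proof. exact: (big_morph f lin_funD lin_fun0). Qed.
End LinearFunctions.

Lemma lin_span_map (k : fieldType) (V W : lmodType k) (f : V -> W)
    (P : V -> Prop) (Q : W -> Prop) :
  linear f -> (forall v, P v -> lin_span Q (f v)) ->
  forall v, lin_span P v -> lin_span Q (f v).
Proof.
move=> lf PQ; apply: lin_span_min => //.
  by rewrite (lin_fun0 lf); exact: lin_span0.
by move=> a x y; rewrite lf; exact: lin_spanP.
Qed.

Lemma lin_spanB (k : fieldType) (V : lmodType k) (P : V -> Prop) x y :
  lin_span P x -> lin_span P y -> lin_span P (x - y).
Proof. by move=> Px Py; rewrite addrC -scaleN1r; exact: lin_spanP. Qed.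

(** The SL2-invariant alternating form on the span of the two products. *)
Definition symp (k : pzRingType) (i j : 'I_2) : k := (j : nat)%:R - (i : nat)%:R.

(** In dimension two every alternating function of three vectors vanishes. *)
Lemma symp_plucker (k : fieldType) (V : lmodType k) (v : 'I_2 -> V) i j l :
  symp k l j *: v i - symp k l i *: v j = symp k i j *: v l.
Proof.
by move: i j l; do 3![elim/forall_I2]; rewrite /symp /= ?subrr ?subr0 ?sub0r
  ?scale0r ?scale1r ?scaleN1r ?subrr ?subr0 ?sub0r ?opprK.
Qed.

(** In dimension two alternating bilinear maps are multiples of the form. *)
Lemma symp_alternating (k : fieldType) (V : lmodType k) (v : 'I_2 -> 'I_2 -> V) i j :
  v i j - v j i = symp k i j *: (v 0 1 - v 1 0).
Proof.
by move: i j; do 2![elim/forall_I2]; rewrite /symp /= ?subrr ?subr0 ?sub0r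
  ?scale0r ?scale1r ?scaleN1r ?opprB.
Qed.

Section CrossedAssociator.
Variables (k : fieldType) (A : lmodType k) (op : 'I_2 -> A -> A -> A).

(** Associativity of all combinations of the two products says that
   (a *_i b) *_j c - a *_i (b *_j c) is alternating in i and j; this is its
   value at (0, 1). *)
Definition cross_assoc a b c : A := op 1 (op 0 a b) c - op 0 a (op 1 b c).

(** An arbitrary d is more convenient than cross_assoc: in an induction d is built
   from the values for smaller elements. *)
Lemma compatible_intro :
  (forall i b, linear (fun a => op i a b)) -> (forall i a, linear (op i a)) ->
  (forall a b c, exists d, forall i j,
     op j (op i a b) c = op i a (op j b c) + symp k i j *: d) ->
  compatible op.
Proof.
move=> opl opr ex; split=> // [i a b c|a b c].
  by have [d ->] := ex a b c; rewrite /symp subrr scale0r addr0.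
have [d E] := ex a b c; rewrite !E /symp subr0 sub0r scale1r scaleN1r.
by rewrite addrACA subrr addr0.
Qed.

Hypothesis opP : compatible op.

Lemma cross_assoc_linear_m a c : linear (fun b => cross_assoc a b c).
Proof.
move=> r x y; rewrite /cross_assoc !(op_linear_r opP, op_linear_l opP) scalerBr.
by rewrite opprD addrACA.
Qed.

Lemma cross_assoc_linear_r a b : linear (cross_assoc a b).
Proof.
move=> r x y; rewrite /cross_assoc !(op_linear_r opP) scalerBr.
by rewrite opprD addrACA.
Qed.

Lemma cross_assocE i j a b c :
  op j (op i a b) c = op i a (op j b c) + symp k i j *: cross_assoc a b c.
Proof.
rewrite /cross_assoc /symp; move: i j; do 2![elim/forall_I2] => /=.
- by rewrite subrr scale0r addr0 -(op_assoc opP).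
- by rewrite subr0 scale1r addrC subrK.
- rewrite sub0r scaleN1r opprB addrA [op 1 a _ + _]addrC -(op_compat opP).
  by rewrite addrAC subrr add0r.
- by rewrite subrr scale0r addr0 -(op_assoc opP).
Qed.

(** The compatibility axiom for (a_u b, c, d), and the one for (b, c, d) multiplied
   by a on the left, share a term up to associativity; what is left after
   cancelling it is this identity. It moves the product into the arguments of
   the cross associator. *)
Lemma cross_assoc_op u a b c d :
  op u (cross_assoc a b c) d = cross_assoc a b (op u c d) - cross_assoc a (op u b c) d.
Proof.
have opl i x y z : op i (x - y) z = op i x z - op i y z.
  exact: (lin_funB (op_linear_l opP i z)).
have opr i x y z : op i x (y + z) = op i x y + op i x z.
  exact: (lin_funD (op_linear_r opP i x)).
have opA i x y z : op i x (op i y z) = op i (op i x y) z := op_assoc opP i x y z.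
have C x y z := op_compat opP x y z.
have cancel_common (x y r s t w v : A) :
    x + y = r + s -> t + w = r + v -> y - w = (s - v) - (x - t).
  move=> e1 e2.
  have -> : y = r + (s - x) by rewrite addrA -e1 addrC addKr.
  have -> : w = r + (v - t) by rewrite addrA -e2 addrC addKr.
  rewrite opprD addrACA subrr add0r !opprB addrACA [RHS]addrACA.
  by rewrite [- x + _]addrC.
move: u; elim/forall_I2.
  have e2 := congr1 (op 0 a) (C b c d); rewrite !opr in e2.
  rewrite /cross_assoc opl -[op 0 (op 0 a _) d]opA [op 0 a (op 0 b c)]opA.
  apply: cancel_common (C (op 0 a b) c d) _.
  by rewrite e2 !opA.
have e2 := congr1 (op 1 a) (C b c d); rewrite !opr in e2.
have cE x y z : cross_assoc x y z = op 1 x (op 0 y z) - op 0 (op 1 x y) z.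
  by rewrite (cross_assocE 1 0) /symp sub0r scaleN1r opprB addrC subrK.
rewrite !cE opl -[op 1 (op 1 a _) d]opA [op 1 a (op 1 b c)]opA.
apply: cancel_common.
  by rewrite addrC [LHS]e2 addrC opA.
by rewrite addrC [LHS]C addrC.
Qed.
End CrossedAssociator.

(** * A model of the free algebra on labelled trees *)

Import finmap monalg.
Local Notation "x @_ t" := (mcoeff t x) : ring_scope.

Section LinearExtension.
Variables (k : fieldType) (K : choiceType).
Local Notation A := {malg k[K]}.

Definition lext (V : lmodType k) (f : K -> V) (x : A) : V :=
  \sum_(t <- msupp x) x@_t *: f t.

Lemma lext_widen (V : lmodType k) (f : K -> V) (x : A) (d : {fset K}) :
  (msupp x `<=` d)%fset -> lext f x = \sum_(t <- d) x@_t *: f t.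
Proof.
move=> xd; rewrite /lext (big_fset_incl _ xd) // => t _ tx.
by rewrite mcoeff_outdom ?scale0r.
Qed.

Lemma lext_linear (V : lmodType k) (f : K -> V) : linear (lext f).
Proof.
move=> a x y; pose d := (msupp x `|` msupp y `|` msupp (a *: x + y))%fset.
rewrite !(@lext_widen _ _ _ d); try by
  apply/fsubsetP => t tx; rewrite !in_fsetU tx ?orbT.
rewrite scaler_sumr -big_split /=; apply: eq_bigr => t _.
by rewrite mcoeffD mcoeffZ scalerDl scalerA.
Qed.

Lemma lext_linear_fun (U V : lmodType k) (f : U -> K -> V) (x : A) :
  (forall t, linear (f^~ t)) -> linear (fun u => lext (f u) x).
Proof.
move=> lf a u v; rewrite /lext scaler_sumr -big_split /=.
by apply: eq_bigr => t _; rewrite lf scalerDr !scalerA mulrC.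
Qed.

Lemma lextU (V : lmodType k) (f : K -> V) t : lext f << t >> = f t.
Proof. by rewrite /lext msuppU oner_eq0 big_seq_fset1 mcoeffUU scale1r. Qed.

Lemma malg_sumE (x : A) : x = \sum_(t <- msupp x) x@_t *: << t >>.
Proof.
rewrite {1}[x]monalgE; apply: eq_bigr => t _.
by apply/malgP => s; rewrite mcoeffZ !mcoeffU mulr_natr.
Qed.

Lemma lin_malg_ext (V : lmodType k) (f g : A -> V) : linear f -> linear g ->
  (forall t, f << t >> = g << t >>) -> f =1 g.
Proof.
move=> lf lg fg x; rewrite [x]malg_sumE !(lin_fun_sum _) //.
by apply: eq_bigr => t _; rewrite (lin_funZ lf) (lin_funZ lg) fg.
Qed.

(** This proves existence statements that are linear in x from their case of basis
   elements, without making the witness a function of x. *)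
Lemma lin_malg_ex (V : lmodType k) (P : A -> V -> Prop) :
  (forall a x y u v, P x u -> P y v -> P (a *: x + y) (a *: u + v)) -> P 0 0 ->
  (forall t, exists u, P << t >> u) -> forall x, exists u, P x u.
Proof.
move=> PD P0 Pt x; rewrite [x]malg_sumE.
elim/big_rec: _ => [|t y _ [v Pv]]; first by exists 0.
by have [u Pu] := Pt t; exists (x@_t *: u + v); apply: PD.
Qed.

End LinearExtension.

(** Un x i t stands for the i-th product of x and t, and Bi x s t for the cross
   associator of x, s and t. *)
Inductive dtree (X : Type) :=
  | Lf of X
  | Un of X & 'I_2 & dtree X
  | Bi of X & dtree X & dtree X.

HB.instance Definition _ (X : Type) := gen_eqMixin (dtree X).
HB.instance Definition _ (X : Type) := gen_choiceMixin (dtree X).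

Section TreeAlgebra.
Variables (k : fieldType) (X : Type).
Local Notation A := {malg k[dtree X]}.
Implicit Types (a b c : A) (x : X) (i j l : 'I_2).

Definition un x i : A -> A := lext (fun t => << Un x i t >>).
Definition bi x a b : A := lext (fun s => lext (fun t => << Bi x s t >>) b) a.

Lemma un_linear x i : linear (un x i).
Proof. exact: lext_linear. Qed.

Lemma bi_linear_l x b : linear (bi x ^~ b).
Proof. exact: lext_linear. Qed.

Lemma bi_linear_r x a : linear (bi x a).
Proof. by apply: lext_linear_fun => s; exact: lext_linear. Qed.

Lemma unU x i t : un x i << t >> = << Un x i t >>.
Proof. exact: lextU. Qed.

Lemma biU x s t : bi x << s >> << t >> = << Bi x s t >>.
Proof. by rewrite /bi !lextU. Qed.

(** Left multiplication by a tree. In a compatible algebra the last two clauses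
   hold by [cross_assocE] and [cross_assoc_op]. *)
Fixpoint tree_mul (t : dtree X) (i : 'I_2) (b : A) : A :=
  match t with
  | Lf x => un x i b
  | Un x j t => un x j (tree_mul t i b) + symp k j i *: bi x << t >> b
  | Bi x s t => bi x << s >> (tree_mul t i b) - bi x (tree_mul s i << t >>) b
  end.

Definition tree_op i a b : A := lext (fun t => tree_mul t i b) a.

Lemma tree_mul_linear t i : linear (tree_mul t i).
Proof.
elim: t => [x|x j t IH|x s IHs t IHt] r b c /=.
- exact: un_linear.
- by rewrite IH un_linear bi_linear_r !scalerDr !scalerA addrACA [_ * r]mulrC.
- by rewrite IHt !bi_linear_r scalerBr opprD addrACA.
Qed.

Lemma tree_op_linear_l i b : linear (fun a => tree_op i a b).
Proof. exact: lext_linear. Qed.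

Lemma tree_op_linear_r i a : linear (tree_op i a).
Proof. by apply: lext_linear_fun => s; exact: tree_mul_linear. Qed.

Let unD x i := lin_funD (un_linear x i).
Let unZ x i := lin_funZ (un_linear x i).
Let biBl x b := lin_funB (bi_linear_l x b).
Let biZl x b := lin_funZ (bi_linear_l x b).
Let biDr x b := lin_funD (bi_linear_r x b).
Let biZr x b := lin_funZ (bi_linear_r x b).
Let opDl i b := lin_funD (tree_op_linear_l i b).
Let opBl i b := lin_funB (tree_op_linear_l i b).
Let opZl i b := lin_funZ (tree_op_linear_l i b).

Lemma tree_op_leaf i x b : tree_op i << Lf x >> b = un x i b.
Proof. by rewrite /tree_op lextU. Qed.

Lemma tree_op_un i x j a b :
  tree_op i (un x j a) b = un x j (tree_op i a b) + symp k j i *: bi x a b.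
Proof.
move: a; apply: lin_malg_ext => [r a c|r a c|t].
- by rewrite un_linear tree_op_linear_l.
- rewrite tree_op_linear_l un_linear bi_linear_l !scalerDr !scalerA addrACA.
  by rewrite [r * symp _ _ _]mulrC.
- by rewrite unU /tree_op !lextU.
Qed.

Lemma tree_op_bi i x a b c : tree_op i (bi x a b) c =
  bi x a (tree_op i b c) - bi x (tree_op i a b) c.
Proof.
move: a; apply: lin_malg_ext => [r a d|r a d|s].
- by rewrite bi_linear_l tree_op_linear_l.
- by rewrite tree_op_linear_l !bi_linear_l scalerBr opprD addrACA.
move: b; apply: lin_malg_ext => [r a d|r a d|t].
- by rewrite bi_linear_r tree_op_linear_l.
- rewrite tree_op_linear_l tree_op_linear_r bi_linear_r bi_linear_l.
  by rewrite scalerBr opprD addrACA.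
by rewrite biU /tree_op !lextU.
Qed.

Opaque un bi tree_op.
(** For a unary tree the defect is alternating by the Pluecker relation; for a
   binary one, what the induction hypotheses leave is antisymmetrized in i, j. *)
Lemma tree_op_assoc a b c : exists d, forall i j,
  tree_op j (tree_op i a b) c = tree_op i a (tree_op j b c) + symp k i j *: d.
Proof.
pose P a d := forall i j,
  tree_op j (tree_op i a b) c = tree_op i a (tree_op j b c) + symp k i j *: d.
move: a; apply: (@lin_malg_ex _ _ _ P).
- move=> r a a' d d' ad ad' i j.
  rewrite !tree_op_linear_l ad ad' !scalerDr !scalerA addrACA.
  by rewrite [r * symp _ _ _]mulrC.
- move=> i j; have op0 l y : tree_op l 0 y = 0 := lin_fun0 (tree_op_linear_l l y).
  by rewrite !op0 scaler0 addr0.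
rewrite {}/P => t; elim: t b c => [x|x l t IH|x s IHs t IHt] b c.
- exists (bi x b c) => i j.
  by rewrite !tree_op_leaf tree_op_un.
- have [d dE] := IH b c; exists (un x l d + bi x (tree_op l << t >> b) c) => i j.
  rewrite -unU !tree_op_un opDl opZl tree_op_un tree_op_bi dE unD unZ.
  rewrite scalerBr [in RHS]scalerDr.
  rewrite -(symp_plucker (fun i => bi x (tree_op i << t >> b) c) i j l).
  move: (un x l (tree_op i _ _)) (symp k i j *: _) (symp k l j *: _)
    (symp k l i *: _) (symp k l i *: _) => u1 u2 u3 u4 u5.
  rewrite -!addrA; congr (_ + _); rewrite [RHS]addrCA; congr (_ + _).
  by rewrite addrCA.
have [d dE] := IHt b c; have [e eE] := IHs << t >> b.
pose F i j := tree_op i << s >> (tree_op j << t >> b).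
exists (bi x << s >> d + bi x (e + (F 0 1 - F 1 0)) c) => i j.
have eF : symp k i j *: (e + (F 0 1 - F 1 0)) =
    tree_op j (tree_op i << s >> << t >>) b - tree_op j << s >> (tree_op i << t >> b).
  by rewrite eE scalerDr -symp_alternating addrCA addrA.
rewrite -biU !tree_op_bi opBl !tree_op_bi dE biDr biZr scalerDr.
rewrite -[symp k i j *: bi x (e + _) c]biZl eF biBl.
move: (bi x << s >> (tree_op _ _ _)) (symp k i j *: _) (bi x (tree_op j << s >> _) c)
  (bi x (tree_op i << s >> _) _) (bi x (tree_op j (tree_op i _ _) _) c) => p q y w z.
rewrite opprB -!addrA; congr (_ + _); rewrite [RHS]addrCA; congr (_ + _).
by rewrite addrCA [RHS]addrCA; congr (_ + _); rewrite addrC.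
Qed.

Lemma tree_compatible : compatible tree_op.
Proof.
apply: compatible_intro; [exact: tree_op_linear_l | exact: tree_op_linear_r |].
exact: tree_op_assoc.
Qed.

Lemma cross_assoc_leaf x a b : cross_assoc tree_op << Lf x >> a b = bi x a b.
Proof.
rewrite /cross_assoc !tree_op_leaf tree_op_un /symp subr0 scale1r.
by rewrite addrC addKr.
Qed.

End TreeAlgebra.

(** * The tree basis of the free algebra *)

Section FreeBasis.
Variables (k : fieldType) (X : Type).
Local Notation F := (free_alg k X).
Local Notation op := (@free_op k X).
Local Notation A := {malg k[dtree X]}.
Implicit Types (t : dtree X) (w : seq X) (x : X).

Let opP : compatible op := free_compatible k X.

Fixpoint teval t : F :=
  match t with
  | Lf x => gen x
  | Un x i t => op i (gen x) (teval t)
  | Bi x s t => cross_assoc op (gen x) (teval s) (teval t)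
  end.

Fixpoint letters t : seq X :=
  match t with
  | Lf x => [:: x]
  | Un x _ t => x :: letters t
  | Bi x s t => x :: letters s ++ letters t
  end.

Definition to_model : F -> A := free_lift (@tree_op k X) (fun x => << Lf x >>).

Lemma to_model_linear : linear to_model.
Proof. exact/free_lift_linear/tree_compatible. Qed.

Lemma to_model_teval t : to_model (teval t) = << t >>.
Proof.
have Mop i a b : to_model (op i a b) = tree_op i (to_model a) (to_model b).
  exact/free_lift_op/tree_compatible.
have Mgen x : to_model (gen x) = << Lf x >> by exact/free_lift_gen/tree_compatible.
elim: t => [x|x i t IH|x s IHs t IHt] /=; first exact: Mgen.
  by rewrite Mop Mgen IH tree_op_leaf unU.
have -> : to_model (cross_assoc op (gen x) (teval s) (teval t)) =
    cross_assoc (@tree_op k X) << Lf x >> << s >> << t >>.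
  by rewrite /cross_assoc (lin_funB to_model_linear) !Mop Mgen IHs IHt.
by rewrite cross_assoc_leaf biU.
Qed.

Definition tree_span w : F -> Prop :=
  lin_span (fun y => exists2 t, letters t = w & y = teval t).

Lemma tree_span_teval t : tree_span (letters t) (teval t).
Proof. by apply: lin_span_gen; exists t. Qed.

Lemma tree_span_un x i w a : tree_span w a -> tree_span (x :: w) (op i (gen x) a).
Proof.
apply: lin_span_map => [|_ [t tw ->]]; first exact: (op_linear_r opP).
by apply: lin_span_gen; exists (Un x i t); rewrite //= tw.
Qed.

Lemma tree_span_bi x v w a b : tree_span v a -> tree_span w b ->
  tree_span (x :: v ++ w) (cross_assoc op (gen x) a b).
Proof.
move=> va wb; move: a va.
apply: lin_span_map => [|_ [s sv ->]]; first exact: cross_assoc_linear_m.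
move: b wb; apply: lin_span_map => [|_ [t tw ->]]; first exact: cross_assoc_linear_r.
by apply: lin_span_gen; exists (Bi x s t); rewrite //= sv tw.
Qed.

(** The factor b is a linear combination, not a tree, because the reductions
   multiply the right factor by subtrees of the left one. *)
Lemma tree_span_op t i w b :
  tree_span w b -> tree_span (letters t ++ w) (op i (teval t) b).
Proof.
elim: t i w b => [x|x l t IH|x s IHs t IHt] i w b wb /=.
- exact: tree_span_un.
- rewrite (cross_assocE opP) addrC; apply: lin_spanP; last exact/tree_span_un/IH.
  exact/tree_span_bi/wb/tree_span_teval.
- rewrite (cross_assoc_op opP) -catA; apply: lin_spanB.
    by apply: tree_span_bi; [exact: tree_span_teval | exact: IHt].
  by rewrite catA; apply/tree_span_bi/wb/IHs/tree_span_teval.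
Qed.

Lemma monomial_tree_span w a : monomial w a -> tree_span w a.
Proof.
elim=> [x|i s t {}a b _ IHa _ IHb]; first exact: (tree_span_teval (Lf x)).
move: a IHa; apply: lin_span_map => [|_ [u <- ->]]; last exact: tree_span_op.
exact: (op_linear_l opP).
Qed.

Lemma span_monomial_op v w i a b :
  lin_span (monomial (k := k) v) a -> lin_span (monomial w) b ->
  lin_span (monomial (v ++ w)) (op i a b).
Proof.
move=> va wb; move: a va; apply: lin_span_map => [|a va].
  exact: (op_linear_l opP).
move: b wb; apply: lin_span_map => [|b wb]; first exact: (op_linear_r opP).
exact/lin_span_gen/monomial_op.
Qed.

Lemma teval_span_monomial t : lin_span (monomial (letters t)) (teval t).
Proof.
have G x : lin_span (monomial [:: x]) (gen x : F) by apply/lin_span_gen/monomial_gen.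
elim: t => [x|x i t IH|x s IHs t IHt] /=; first exact: G.
  exact: (@span_monomial_op [:: x]).
apply: lin_spanB; last by apply: (@span_monomial_op [:: x]) => //; exact: span_monomial_op.
by rewrite -cat_cons; apply: span_monomial_op => //; exact: (@span_monomial_op [:: x]).
Qed.

Fixpoint shape_of t : shape :=
  match t with
  | Lf _ => Leaf
  | Un _ _ t => Unary (shape_of t)
  | Bi _ s t => Binary (shape_of s) (shape_of t)
  end.

Fixpoint labels t : seq 'I_2 :=
  match t with
  | Lf _ => [::]
  | Un _ i t => i :: labels t
  | Bi _ s t => labels s ++ labels t
  end.

Lemma size_labels t : size (labels t) = unaries (shape_of t).
Proof. by elim: t => //= [_ _ t ->|_ s IHs t IHt] //; rewrite size_cat IHs IHt. Qed.

Lemma size_letters t : size (letters t) = nodes (shape_of t).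
Proof. by elim: t => //= [_ _ t ->|_ s IHs t IHt] //; rewrite size_cat IHs IHt. Qed.

Variable x0 : X.

(** Prefix notation: s is filled with the labels w and the letters l. The defaults
   0 and x0 are only met when w or l is too short. *)
Fixpoint build (s : shape) (w : seq 'I_2) (l : seq X) : dtree X :=
  let x := head x0 l in let l := behead l in
  match s with
  | Leaf => Lf x
  | Unary s => Un x (head 0 w) (build s (behead w) l)
  | Binary s t => Bi x (build s (take (unaries s) w) (take (nodes s) l))
                       (build t (drop (unaries s) w) (drop (nodes s) l))
  end.

Lemma buildK t : build (shape_of t) (labels t) (letters t) = t.
Proof.
elim: t => //= [x i t ->|x s IHs t IHt] //.
rewrite !take_size_cat ?size_labels ?size_letters //.
by rewrite !drop_size_cat ?size_labels ?size_letters // IHs IHt.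
Qed.

Lemma build_inv s (w : seq 'I_2) (l : seq X) : size w = unaries s -> size l = nodes s ->
  [/\ shape_of (build s w l) = s, labels (build s w l) = w &
      letters (build s w l) = l].
Proof.
elim: s w l => [|s IH|s IHs t IHt] w [|x l] //=.
- by move=> /size0nil -> [] /size0nil ->.
- by case: w => //= i w [sw] [sl]; have [-> -> ->] := IH _ _ sw sl.
move=> sw [sl].
have [||-> -> ->] := IHs (take (unaries s) w) (take (nodes s) l).
- by rewrite size_takel // sw leq_addr.
- by rewrite size_takel // sl leq_addr.
have [||-> -> ->] := IHt (drop (unaries s) w) (drop (nodes s) l).
- by rewrite size_drop sw addKn.
- by rewrite size_drop sl addKn.
by rewrite !cat_take_drop.
Qed.

End FreeBasis.

(** * The action on the tree basis *)

Section Action.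
Variables (k : fieldType) (n : nat).
Local Notation X := 'I_n.
Local Notation op := (@free_op k X).
Variable sg : ('S_n * SL2 k)%type.
Local Notation act := (free_act sg).

Let actL : linear act := free_act_linear sg.

(** The cross associator spans the second exterior power of the span of the
   products, on which g acts by its determinant, which is 1. *)
Lemma free_act_cross_assoc a b c :
  act (cross_assoc op a b c) = cross_assoc op (act a) (act b) (act c).
Proof.
have opP := free_compatible k X; pose g := sg.2.
have E i j : act (op j (op i a b) c) - act (op i a (op j b c)) =
    \sum_p \sum_q (g p i * g q j * symp k p q) *: cross_assoc op (act a) (act b) (act c).
  rewrite !free_act_op.
  under eq_bigr => q _ do rewrite (lin_fun_sum (op_linear_l opP q _)) scaler_sumr.
  under [X in _ - X]eq_bigr => p _ do
    rewrite (lin_fun_sum (op_linear_r opP p _)) scaler_sumr.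
  rewrite exchange_big -sumrB /=; apply: eq_bigr => p _.
  rewrite -sumrB; apply: eq_bigr => q _.
  rewrite (lin_funZ (op_linear_l opP q _)) (lin_funZ (op_linear_r opP p _)) !scalerA.
  rewrite (cross_assocE opP) [g q j * _]mulrC -scalerBr addrC addKr.
  by rewrite scalerA.
rewrite {1}/cross_assoc (lin_funB actL) E !big_I2 -!scalerDl.
rewrite -[RHS]scale1r -(SL2_det2 g) /symp /=; congr (_ *: _).
by rewrite modn_small //; ring.
Qed.

Variable x0 : X.
Local Notation permute := (map (fun i => (sg.1^-1)%g i)).

(** Permutations act on the letters alone and SL2 on the labels alone, each label
   spanning a standard module. *)
Lemma free_act_build s w l : size w = unaries s -> size l = nodes s ->
  act (teval k (build x0 s w l)) =
  \sum_(v : (unaries s).-tuple 'I_2)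
     word_coef sg.2 v w *: teval k (build x0 s v (permute l)).
Proof.
have opP := free_compatible k X.
elim: s w l => [|s IH|s IHs t IHt] w [|x l] //=.
- move=> /size0nil -> _; rewrite free_act_gen.
  rewrite (big_tuple0 (fun v => word_coef sg.2 v [::] *: gen _)).
  by rewrite word_coef_nil scale1r.
- case: w => //= i w [sw] [sl]; rewrite free_act_op (IH _ _ sw sl) free_act_gen.
  rewrite (big_tupleS _ (fun v => word_coef sg.2 v (i :: w) *: op (head 0 v) _
    (teval k (build x0 s (behead v) _)))).
  apply: eq_bigr => j _; rewrite (lin_fun_sum (op_linear_r opP j _)) scaler_sumr.
  apply: eq_bigr => v _; rewrite (lin_funZ (op_linear_r opP j _)) scalerA.
  by rewrite word_coef_cons.
move=> sw [sl]; rewrite free_act_cross_assoc free_act_gen.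
have s1 : size (take (unaries s) w) = unaries s by rewrite size_takel // sw leq_addr.
have s2 : size (take (nodes s) l) = nodes s by rewrite size_takel // sl leq_addr.
have s3 : size (drop (unaries s) w) = unaries t by rewrite size_drop sw addKn.
have s4 : size (drop (nodes s) l) = nodes t by rewrite size_drop sl addKn.
rewrite (IHs _ _ s1 s2) (IHt _ _ s3 s4).
rewrite (big_tuple_cat _ _ (fun v => word_coef sg.2 v w *: cross_assoc op _
  (teval k (build x0 s (take (unaries s) v) _))
  (teval k (build x0 t (drop (unaries s) v) _)))).
rewrite (lin_fun_sum (cross_assoc_linear_m opP _ _)); apply: eq_bigr => u _.
rewrite (lin_funZ (cross_assoc_linear_m opP _ _)).
rewrite (lin_fun_sum (cross_assoc_linear_r opP _ _)) scaler_sumr; apply: eq_bigr => v _.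
rewrite (lin_funZ (cross_assoc_linear_r opP _ _)) scalerA.
rewrite take_size_cat ?drop_size_cat ?size_tuple // -map_take -map_drop.
rewrite -[in word_coef _ (u ++ v) _](cat_take_drop (unaries s) w).
by rewrite word_coef_cat // size_tuple.
Qed.

End Action.

(** * The multilinear component *)

Section Multilinear.
Variables (k : fieldType) (n' : nat).
Local Notation n := n'.+1.
Local Notation F := (free_alg k 'I_n).

Definition shape_at (j : 'I_(size (shapes n))) : shape := nth Leaf (shapes n) j.

Lemma nodes_shape_at j : nodes (shape_at j) = n.
Proof. by apply/eqP; rewrite -mem_shapes mem_nth. Qed.

Lemma shape_at_inj : injective shape_at.
Proof.
by move=> i j /eqP; rewrite nth_uniq ?uniq_shapes // => /eqP /val_inj.
Qed.

Lemma shape_at_surj s : nodes s = n -> exists j, shape_at j = s.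
Proof.
move/eqP; rewrite -mem_shapes => sn.
have lt : (index s (shapes n) < size (shapes n))%N by rewrite index_mem.
by exists (Ordinal lt); rewrite /shape_at nth_index.
Qed.

Lemma sum_shape_at (G : shape -> nat) :
  (\sum_j G (shape_at j) = \sum_(s <- shapes n) G s)%N.
Proof. by rewrite (big_nth Leaf) big_mkord. Qed.

(** Each unary node of a shape contributes a standard module, spanned by its two
   possible labels. *)
Definition tree_rep : rep k (SL2 k) :=
  dsum (fun j => tensor_pow k (unaries (shape_at j))).

(** The inverse makes this equivariant, as permutations compose from left to
   right. *)
Definition perm_word (t : 'S_n) : seq 'I_n := [seq (t^-1)%g i | i <- enum 'I_n].

Lemma size_perm_word t : size (perm_word t) = n.
Proof. by rewrite size_map size_enum_ord. Qed.

Lemma perm_wordM (s t : 'S_n) :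
  perm_word (s * t) = [seq (s^-1)%g i | i <- perm_word t].
Proof. by rewrite -map_comp; apply: eq_map => i; rewrite /= invMg permM. Qed.

Lemma perm_word_inj : injective perm_word.
Proof.
move=> s t /eq_in_map st; apply: invg_inj; apply/permP => i.
by apply: st; rewrite mem_enum.
Qed.

Lemma count_perm_word t i : count_mem i (perm_word t) = 1%N.
Proof.
have u : uniq (perm_word t) by rewrite (map_inj_uniq (@perm_inj _ _)) enum_uniq.
rewrite count_uniq_mem //.
have -> // : i \in perm_word t.
by apply/mapP; exists (t i); rewrite ?mem_enum ?permK.
Qed.

Lemma perm_word_surj (l : seq 'I_n) :
  (forall i, count_mem i l = 1%N) -> exists t, l = perm_word t.
Proof.
move=> l1.
have pl : perm_eq l (enum 'I_n).
  apply/allP => i _ /=; rewrite l1 count_uniq_mem ?enum_uniq //.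
  by rewrite mem_enum.
have sl : size l == n by rewrite (perm_size pl) size_enum_ord.
have inj : injective (fun i : 'I_n => nth ord0 l i).
  move=> i j /eqP; rewrite nth_uniq ?(eqP sl) //; first by move/eqP/val_inj.
  by rewrite (perm_uniq pl) enum_uniq.
exists (perm inj)^-1%g; rewrite /perm_word invgK.
rewrite -[LHS](mkseq_nth ord0) /mkseq (eqP sl) -val_enum_ord -map_comp.
by apply: eq_map => i; rewrite /= permE.
Qed.

Definition basis_tree (t : 'S_n) j (w : seq 'I_2) : dtree 'I_n :=
  build ord0 (shape_at j) w (perm_word t).

Lemma basis_tree_inv t j w : size w = unaries (shape_at j) ->
  [/\ shape_of (basis_tree t j w) = shape_at j, labels (basis_tree t j w) = w &
      letters (basis_tree t j w) = perm_word t].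
Proof. by move=> sw; apply: build_inv; rewrite ?size_perm_word ?nodes_shape_at. Qed.

Definition of_coords (f : {ffun 'S_n -> tree_rep}) : F :=
  \sum_t \sum_j \sum_(w : (unaries (shape_at j)).-tuple 'I_2)
    tensor_coord (f t j) w *: teval k (basis_tree t j w).

Lemma of_coords_linear : linear of_coords.
Proof.
move=> a f g; rewrite /of_coords scaler_sumr -big_split; apply: eq_bigr => t _.
rewrite scaler_sumr -big_split; apply: eq_bigr => j _.
rewrite scaler_sumr -big_split; apply: eq_bigr => w _.
by rewrite !ffunE tensor_coordD scalerDl scalerA.
Qed.

Lemma teval_multilinear t j (w : (unaries (shape_at j)).-tuple 'I_2) :
  teval k (basis_tree t j w) \in @multilinear k n.
Proof.
have [_ _ lE] := basis_tree_inv t (size_tuple w).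
apply/asboolP; have := teval_span_monomial k (basis_tree t j w); rewrite lE.
apply: (@lin_span_map _ _ _ id) => // a aw; apply: lin_span_gen.
by exists (perm_word t) => //; exact: count_perm_word.
Qed.

Lemma of_coords_multilinear f : of_coords f \in @multilinear k n.
Proof.
apply: rpred_sum => t _; apply: rpred_sum => j _; apply: rpred_sum => w _.
exact/rpredZ/teval_multilinear.
Qed.

(** The model recovers all coordinates, since the three data of a basis tree can
   be read off; hence [of_coords] is injective. *)
Lemma to_model_of_coords f t j (w : (unaries (shape_at j)).-tuple 'I_2) :
  (to_model (of_coords f))@_(basis_tree t j w) = tensor_coord (f t j) w.
Proof.
have lM := @to_model_linear k 'I_n.
have [sE bE lE] := basis_tree_inv t (size_tuple w).
rewrite (lin_fun_sum lM) raddf_sum (bigD1 t) //=.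
rewrite [X in _ + X]big1 ?addr0 => [|t' t't].
  rewrite (lin_fun_sum lM) raddf_sum (bigD1 j) //=.
  rewrite [X in _ + X]big1 ?addr0 => [|j' j'j].
    rewrite (lin_fun_sum lM) raddf_sum (bigD1 w) //=.
    rewrite [X in _ + X]big1 ?addr0 => [|w' w'w].
      by rewrite (lin_funZ lM) to_model_teval mcoeffZ mcoeffUU mulr1.
    rewrite (lin_funZ lM) to_model_teval mcoeffZ mcoeffU.
    case: eqP => [e|]; last by rewrite mulr0.
    case/eqP: w'w; apply: val_inj; rewrite /= -bE -e.
    by have [_ ->] := basis_tree_inv t (size_tuple w').
  rewrite (lin_fun_sum lM) raddf_sum big1 //= => w' _.
  rewrite (lin_funZ lM) to_model_teval mcoeffZ mcoeffU.
  case: eqP => [e|]; last by rewrite mulr0.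
  case/eqP: j'j; apply: shape_at_inj; rewrite -sE -e.
  by have [->] := basis_tree_inv t (size_tuple w').
rewrite (lin_fun_sum lM) raddf_sum big1 //= => j' _.
rewrite (lin_fun_sum lM) raddf_sum big1 //= => w' _.
rewrite (lin_funZ lM) to_model_teval mcoeffZ mcoeffU.
case: eqP => [e|]; last by rewrite mulr0.
case/eqP: t't; apply: perm_word_inj; rewrite -lE -e.
by have [_ _ ->] := basis_tree_inv t' (size_tuple w').
Qed.

Lemma of_coords_surj x : x \in @multilinear k n -> exists f, of_coords f = x.
Proof.
move=> /asboolP; have L := of_coords_linear.
have Q0 : exists f, of_coords f = 0 by exists 0; rewrite (lin_fun0 L).
have QD a y z : (exists f, of_coords f = y) -> (exists f, of_coords f = z) ->
    exists f, of_coords f = a *: y + z.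
  by move=> [f <-] [g <-]; exists (a *: f + g); rewrite L.
pose hit y := exists f, of_coords f = y.
apply: (@lin_span_min _ _ _ hit) => // {}x.
move=> [l /monomial_tree_span xl /perm_word_surj [t lt]].
move: {xl} x xl; apply: (@lin_span_min _ _ _ hit) => // _ [u ul ->].
have [j jE] : exists j, shape_at j = shape_of u.
  by apply: shape_at_surj; rewrite -size_letters ul lt size_perm_word.
have uE : basis_tree t j (labels u) = u by rewrite /basis_tree jE -lt -ul buildK.
have su : size (labels u) == unaries (shape_at j) by rewrite size_labels jE.
exists [ffun t' => finfun (fun j' => tensor_of_coord (unaries (shape_at j'))
  (fun w => [&& t' == t, j' == j & w == labels u]%:R : k)) : tree_rep].
rewrite /of_coords (bigD1 t) //= [X in _ + X]big1 ?addr0 => [|t' t't]; last first.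
  rewrite big1 // => j' _; rewrite big1 // => w _.
  by rewrite !ffunE tensor_of_coordK ?size_tuple // (negPf t't) scale0r.
rewrite (bigD1 j) //= [X in _ + X]big1 ?addr0 => [|j' j'j]; last first.
  rewrite big1 // => w _.
  by rewrite !ffunE tensor_of_coordK ?size_tuple // (negPf j'j) andbF scale0r.
rewrite (bigD1 (Tuple su)) //= [X in _ + X]big1 ?addr0 => [|w wu]; last first.
  rewrite !ffunE tensor_of_coordK ?size_tuple // !eqxx /=.
  by rewrite -(inj_eq val_inj) /= in wu; rewrite (negPf wu) scale0r.
rewrite !ffunE tensor_of_coordK ?(eqP su) // !eqxx scale1r.
by rewrite /= uE.
Qed.

Lemma of_coords_act (sg : 'S_n * SL2 k) (f : regular_tensor 'S_n tree_rep) :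
  of_coords (rep_act sg f) = free_act sg (of_coords f).
Proof.
have lA := free_act_linear sg; case: sg lA => [s g] lA.
rewrite /of_coords (lin_fun_sum lA) (reindex_inj (mulgI s)) /=.
apply: eq_bigr => t _; rewrite (lin_fun_sum lA); apply: eq_bigr => j _.
rewrite (lin_fun_sum lA).
have e : size (perm_word t) = nodes (shape_at j).
  by rewrite size_perm_word nodes_shape_at.
under [RHS]eq_bigr => w _ do
  rewrite (lin_funZ lA) (free_act_build _ _ (size_tuple w) e) scaler_sumr.
rewrite [RHS]exchange_big /=; apply: eq_bigr => v _.
rewrite !ffunE /= mulKg tensor_coord_act scaler_suml; apply: eq_bigr => w _.
by rewrite /basis_tree perm_wordM scalerA mulrC.
Qed.

Lemma As2_tree_rep : rep_iso (As2_rep k n) (regular_tensor 'S_n tree_rep).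
Proof.
pose f (x : {ffun 'S_n -> tree_rep}) : As2 k n := As2of (of_coords_multilinear x).
pose f' (y : As2 k n) : {ffun 'S_n -> tree_rep} :=
  projT1 (cid (of_coords_surj (valP y))).
have f'K : cancel f' f.
  by move=> y; apply: val_inj; exact: (projT2 (cid (of_coords_surj (valP y)))).
have injf : injective f.
  move=> x y /(congr1 val) /= xy; apply/ffunP => t; apply/ffunP => j.
  apply: tensor_coord_inj => w; rewrite -!to_model_of_coords.
  by rewrite xy.
apply: rep_iso_sym.
apply: (@rep_isoI _ _ (regular_tensor 'S_n tree_rep) (As2_rep k n) f f') => //.
- by move=> a x y; apply: val_inj; exact: of_coords_linear.
- by move=> x; apply: injf; rewrite f'K.
- by move=> sg x; apply: val_inj; exact: of_coords_act.
Qed.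

(** Each basis element of [tree_rep] spans a copy of the regular representation. *)
Lemma tree_rep_regular :
  rep_iso (resl (regular_tensor 'S_n tree_rep))
          (rep_power (regular k 'S_n) (catalan n)).
Proof.
pose labelling j : finType := (unaries (shape_at j)).-tuple 'I_2.
pose B : finType := {j & labelling j}.
have <- : #|B| = catalan n.
  rewrite -shapes_count -(sum_shape_at (fun s => 2 ^ unaries s)%N) card_tagged.
  rewrite sumnE big_map big_enum; apply: eq_bigr => j _.
  by rewrite card_tuple card_ord.
pose f (x : {ffun 'S_n -> tree_rep}) : rep_power (regular k 'S_n) #|B| :=
  finfun (fun b : 'I_#|B| =>
    [ffun t => tensor_coord (x t (tag (enum_val b))) (tagged (enum_val b))]
      : regular k 'S_n).
pose coord (y : rep_power (regular k 'S_n) #|B|) (t : 'S_n) (b : B) : k :=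
  (y (enum_rank b) : {ffun 'S_n -> k^o}) t.
pose f' (y : rep_power (regular k 'S_n) #|B|) : {ffun 'S_n -> tree_rep} :=
  [ffun t => finfun (fun j => tensor_of_coord (unaries (shape_at j)) (fun w =>
    if insub w is Some w' then coord y t (Tagged labelling (w' : labelling j)) else 0))
      : tree_rep].
apply: (@rep_isoI _ _ (resl (regular_tensor 'S_n tree_rep))
  (rep_power (regular k 'S_n) #|B|) f f').
- by move=> a x y; apply/ffunP => b; apply/ffunP => t; rewrite !ffunE tensor_coordD.
- move=> x; apply/ffunP => t; apply/ffunP => j; apply: tensor_coord_inj => w.
  by rewrite !ffunE tensor_of_coordK ?size_tuple // valK /coord !ffunE enum_rankK.
- move=> y; apply/ffunP => b; apply/ffunP => t.
  rewrite !ffunE tensor_of_coordK ?size_tuple // valK /coord.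
  by rewrite -[b in RHS]enum_valK; case: (enum_val b).
- move=> s x; apply/ffunP => b; apply/ffunP => t.
  by rewrite !ffunE rep_act1.
Qed.

Lemma decomposes_tree_rep : [pchar k] =i pred0 -> decomposes tree_rep
  (fun d => \sum_(i < n'./2.+1) L_mult n i * (d == n' - i.*2))%N.
Proof.
move=> char0.
apply: decomposes_ext (decomposes_dsum (fun j => decomposes_tensor_pow _ char0)) => d.
by rewrite -shapes_mult -(sum_shape_at (fun s => tensor_mult (unaries s) d)).
Qed.

End Multilinear.

Lemma decomposes_power (k : fieldType) (m c : nat) :
  decomposes (rep_power (L k m) c) (fun d => c * (d == m))%N.
Proof.
apply: decomposes_ext (decomposes_dsum (fun _ : 'I_c => decomposes_L k m)) => d.
by rewrite sum_nat_const card_ord.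
Qed.

Theorem corollary1 (k : fieldType) (char0 : [pchar k] =i pred0)
    (n : nat) (n_gt0 : (0 < n)%N) :
  rep_iso (resl (As2_rep k n)) (rep_power (regular k 'S_n) (catalan n)) /\
  rep_iso (As2_rep k n)
    (regular_tensor 'S_n
       (dsum (fun i : 'I_((n.-1)./2.+1) =>
          rep_power (L k (n.-1 - i.*2)%N) (L_mult n i)))).
Proof.
case: n n_gt0 => // n _; split.
  exact: rep_iso_trans (resl_iso (As2_tree_rep k n)) (tree_rep_regular k n).
apply: rep_iso_trans (As2_tree_rep k n) _; apply: regular_tensor_iso.
apply: decomposes_iso (decomposes_tree_rep n char0) _.
exact: decomposes_dsum (fun i => decomposes_power k _ _).
Qed.
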